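(* Let $0<\alpha\le1$ and $\nu>0$. For $\xi>0$ let $\langle n\rangle(t,\xi)=\sum_{n=0}^\infty n\,\Phi^{(n)}(t,\xi)$, $t\in\mathbb{N}_0$, be the expected number of arrivals in $[0,t]$ of the Prabhakar discrete-time process (PDTP) with parameters $\alpha,\nu,\xi$. (i) If $0<\xi<1$, then for all $t\in\mathbb{N}_0$, $$\langle n\rangle(t,\xi)=\sum_{m=0}^{\infty}\sum_{n=1}^{t}\frac{(-1)^m}{m!}\,\xi^{\nu n+m}\,\frac{(n\nu)_m}{(t-n)!}\left(\alpha(m+n\nu)+1\right)_{t-n}.$$ (ii) For every $\xi_0>0$ and $t>0$, as $h\to0$ with $t/h\in\mathbb{N}$, $$\lim_{h\to0}\langle n\rangle\!\left(\frac th,\xi_0h^{\alpha}\right)=\sum_{n=1}^{\infty}\xi_0^{\nu n}t^{\alpha\nu n}E^{\nu n}_{\alpha,\alpha\nu n+1}(-\xi_0t^{\alpha}).$$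
   Context: $\mathbb{N}_0=\{0,1,2,\dots\}$; $(c)_0=1$, $(c)_m=c(c+1)\cdots(c+m-1)$. The PDTP with parameters $\alpha,\nu,\xi$ is the discrete-time renewal process with arrival times $J_0=0$, $J_n=\sum_{j=1}^nZ_j$, where the $Z_j$ are i.i.d. $\{1,2,\dots\}$-valued with generating function $\mathbb{E}u^{Z_j}=\frac{\xi^{\nu}u}{(\xi+(1-u)^{\alpha})^{\nu}}$, $|u|\le 1$ (principal branches). Its state probabilities are $\Phi^{(n)}(t,\xi)=\mathbb{P}(J_n\le t<J_{n+1})$ for $n,t\in\mathbb{N}_0$. The Prabhakar function is $E_{a,b}^c(z)=\sum_{m=0}^{\infty}\frac{(c)_m}{m!}\frac{z^m}{\Gamma(am+b)}$. *)

(* Defs.v *)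
From HB Require Import structures.
From mathcomp Require Import all_boot all_order all_algebra finmap.
From mathcomp Require Import complex.
From mathcomp Require Import all_classical all_reals all_analysis.

Set Implicit Arguments.
Unset Strict Implicit.
Unset Printing Implicit Defensive.

Import Order.TTheory GRing.Theory Num.Theory.
Import numFieldNormedType.Exports.

Local Open Scope classical_set_scope.
Local Open Scope ring_scope.
Local Open Scope complex_scope.

(* The Pochhammer symbol (c)_m = c (c + 1) ... (c + m - 1). *)
Definition pochhammer (R : realType) (c : R) (m : nat) : R :=
  \prod_(i < m) (c + i%:R).

(* Euler's integral; meaningful for x > 0 only. *)
Definition Gamma (R : realType) (x : R) : R :=
  \int[@lebesgue_measure R]_(s in `]0, +oo[) (s `^ (x - 1) * expR (- s)).

(* E_{a,b}^c(z); meaningful for a, b > 0, where every Gamma value is given by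
   Euler's integral and the series converges for all z. *)
Definition prabhakar (R : realType) (a b c z : R) : R :=
  limn (series (fun m : nat =>
    pochhammer c m / m`!%:R * (z ^+ m / Gamma (a * m%:R + b)))).

(* The principal argument, in ]-pi, pi] for z != 0. *)
Definition principal_arg (R : realType) (z : R[i]) : R :=
  if 0 <= complex.Im z then acos (complex.Re z / ComplexField.Normc.normc z)
  else - acos (complex.Re z / ComplexField.Normc.normc z).

(* The principal branch of z ^ a for a real exponent, with 0 ^ a = 0 for
   a != 0. *)
Definition principal_pow (R : realType) (z : R[i]) (a : R) : R[i] :=
  (ComplexField.Normc.normc z `^ a)%:C *
  (cos (a * principal_arg z) +i* sin (a * principal_arg z)).

Section renewal.
Context {d : measure_display} {T : measurableType d} {R : realType}.
Variable P : probability T R.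

(* Indices are shifted: Z 0, Z 1, ... stand for Z_1, Z_2, ... *)
Variable Z : nat -> {RV P >-> nat}.

Definition mutually_independent : Prop :=
  forall (I : {fset nat}) (B : nat -> set nat), (forall j, measurable (B j)) ->
    P (\bigcap_(j in [set` I]) (Z j @^-1` B j)) =
    (\prod_(j <- I) P (Z j @^-1` B j))%E.

Definition identically_distributed : Prop :=
  forall (i j : nat) (B : set nat), measurable B ->
    P (Z i @^-1` B) = P (Z j @^-1` B).

(* The value at u of the generating function of Z_j is g; the expectation of a
   complex random variable is taken componentwise. *)
Definition pgf_at (j : nat) (u g : R[i]) : Prop :=
  ('E_P[fun w => complex.Re (u ^+ Z j w)%R] = (complex.Re g)%:E)%E /\
  ('E_P[fun w => complex.Im (u ^+ Z j w)%R] = (complex.Im g)%:E)%E.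

Definition arrival (n : nat) (w : T) : nat := (\sum_(j < n) Z j w)%N.

Definition state_prob (n t : nat) : \bar R :=
  P [set w | (arrival n w <= t < arrival n.+1 w)%N].

(* The expected number of arrivals in [0, t]. *)
Definition mean_arrivals (t : nat) : \bar R :=
  (\sum_(0 <= n <oo) n%:R%:E * state_prob n t)%E.

Record is_PDTP (alpha nu xi : R) : Prop := {
  PDTP_positive : forall j w, (0 < Z j w)%N;
  PDTP_independent : mutually_independent;
  PDTP_identical : identically_distributed;
  PDTP_pgf : forall (j : nat) (u : R[i]), ComplexField.Normc.normc u <= 1 ->
    pgf_at j u ((xi `^ nu)%:C * u /
      principal_pow (xi%:C + principal_pow (1 - u) alpha) nu)
}.

End renewal.

(* Main.v *)
(* The mean number of arrivals in [0, t] is the sum over n >= 1 of P(J_n <= t),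
   and P(J_n <= t) is the coefficient of u ^ t in
     G(u) ^ n / (1 - u) = xi ^ (nu n) u ^ n (xi + (1 - u) ^ alpha) ^ (- nu n) / (1 - u).
   For u near 0 one has xi < (1 - u) ^ alpha; expanding in powers of
   xi / (1 - u) ^ alpha, then each power of 1 - u in powers of u, and comparing
   coefficients gives (i).

   For (ii), put h = t / N and x = xi0 t ^ alpha, so that xi = x N ^ (- alpha).
   The terms of (i) converge because (c + 1)_N / N! ~ N ^ c / Gamma(c + 1).
   Domination comes from generating functions at the point u = 1 - K / N with
   K ^ alpha = 2 x: the coefficient (c + 1)_N / N! is at most
   u ^ (- N) (1 - u) ^ (- c), which makes the terms summable in m uniformly in N,
   and P(J_n <= N) is at most u ^ (- N) G(u) ^ n, which is geometric in n. *)
Require Import Defs.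
From HB Require Import structures.
From mathcomp Require Import all_boot all_order all_algebra finmap complex.
From mathcomp Require Import all_classical all_reals all_analysis.
From mathcomp Require Import measurable_realfun.
From mathcomp Require Import ring lra.

Set Implicit Arguments.
Unset Strict Implicit.
Unset Printing Implicit Defensive.

Import Order.TTheory GRing.Theory Num.Theory.
Import numFieldNormedType.Exports.
Local Open Scope classical_set_scope.
Local Open Scope ring_scope.

(** * Series of real numbers *)

Section has_sum.
Context {R : realType}.
Implicit Types (a b : R^nat) (l : R).

(** At real [u] in [0, 1) the principal powers are ordinary real powers, so the comparison of
    coefficients is a real-variable argument: two power series that agree on an interval to the
    right of 0 have equal coefficients. Reordering the double series behind (i) is allowed because
    removing the signs only replaces the argument - xi / (1 - u) ^ alpha of the binomial series by
    its absolute value, still below 1.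

    The limit (ii) applies dominated convergence for series twice, over m for fixed n and then over
    n. With K ^ alpha = 2 x the majorant in m sums to e ^ (2 K) 2 ^ (- nu n) (1 - 1/2) ^ (- nu n) =
    e ^ (2 K), which does not decay in n. The decay is taken from P(J_n <= N) itself, in which the
    alternating signs are already summed: there G(u) <= (xi / (xi + 2 xi)) ^ nu = 3 ^ (- nu).

    The growth of (c + 1)_N / N! rests on the single inequality x ^ c Gamma(x + 1) <= Gamma(x + c +
    1), which gives the lower bound directly and the upper bound after moving up to an integer
    argument. *)

Definition has_sum a l : Prop := series a @ \oo --> l.

Lemma has_sum_unique a l (m : R) : has_sum a l -> has_sum a m -> l = m.
Proof. by move=> al am; rewrite -(cvg_lim _ al)// -(cvg_lim _ am). Qed.

Lemma has_sum_ext a b l : has_sum a l -> a =1 b -> has_sum b l.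
Proof. by move=> + /funext <-. Qed.

Lemma has_sumD a b l (m : R) :
  has_sum a l -> has_sum b m -> has_sum (fun k => a k + b k) (l + m).
Proof.
move=> al bm; rewrite /has_sum (_ : series _ = series a + series b).
  exact: cvgD.
by rewrite -seriesD.
Qed.

Lemma has_sumZ a l c : has_sum a l -> has_sum (fun k => c * a k) (c * l).
Proof.
move=> al; rewrite /has_sum (_ : series _ = c *: series a).
  exact: cvgZr.
by rewrite -seriesZ.
Qed.
Arguments has_sumZ {a l} c _.

Lemma has_sumB a b l (m : R) :
  has_sum a l -> has_sum b m -> has_sum (fun k => a k - b k) (l - m).
Proof.
move=> al bm; have := has_sumD al (has_sumZ (-1) bm).
by rewrite mulN1r => /has_sum_ext; apply => k; rewrite mulN1r.
Qed.

Lemma has_sum_sum (I : Type) (r : seq I) (P : pred I) (a : I -> R^nat)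
    (l : I -> R) : (forall i, P i -> has_sum (a i) (l i)) ->
  has_sum (fun k => \sum_(i <- r | P i) a i k) (\sum_(i <- r | P i) l i).
Proof.
move=> al; rewrite /has_sum.
rewrite (_ : series _ = fun n => \sum_(i <- r | P i) series (a i) n).
  by apply: (@cvg_big _ _ _ _ _ add_continuous) => i /al.
by apply/funext => n; rewrite /series/= exchange_big.
Qed.

Lemma has_sum_shift a l n :
  has_sum a l -> has_sum (fun k => if (k < n)%N then 0 else a (k - n)%N) l.
Proof.
move=> al; rewrite /has_sum -(cvg_shiftn n) /=.
apply: cvg_trans al; apply: near_eq_cvg; near=> k.
apply/esym; rewrite /series/= addnC (big_cat_nat (n := n))//= ?leq_addr//.
rewrite [X in X + _ = _]big1_seq ?add0r; last first.
  by move=> i; rewrite mem_index_iota => /andP[_ /andP[_ ->]].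
rewrite -[X in \big[_/_]_(X <= _ < _) _]add0n big_addn addKn.
apply: eq_bigr => i _; rewrite ifF ?addnK//.
by apply/negbTE; rewrite -leqNgt leq_addl.
Unshelve. all: by end_near. Qed.
Arguments has_sum_shift {a l} n _.

Lemma has_sum_behead a l : has_sum a l -> has_sum (fun k => a k.+1) (l - a 0%N).
Proof.
move=> al; rewrite /has_sum.
rewrite (_ : series _ = fun n => series a n.+1 - a 0%N).
  apply: cvgB; last exact: cvg_cst.
  by rewrite (cvg_shiftS (series a)).
by apply/funext => n; rewrite /series/= big_nat_recl// addrC addKr.
Qed.

Lemma has_sum_le a l n : (forall k, 0 <= a k) -> has_sum a l -> series a n <= l.
Proof.
move=> a0 al; rewrite -(cvg_lim _ al)//.
apply: nondecreasing_cvgn_le; last by apply/cvg_ex; exists l.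
exact: nondecreasing_series.
Qed.

Lemma has_sum_ge0 a l : (forall k, 0 <= a k) -> has_sum a l -> 0 <= l.
Proof. by move=> a0 /(has_sum_le 0 a0); rewrite /series/= big_geq. Qed.

Lemma has_sum_term_le a l n : (forall k, 0 <= a k) -> has_sum a l -> a n <= l.
Proof.
move=> a0 /(has_sum_le n.+1 a0); apply: le_trans.
by rewrite /series/= big_nat_recr//= lerDr sumr_ge0.
Qed.

Lemma has_sum_cvg a l : has_sum a l -> cvgn (series a).
Proof. by move=> al; apply/cvg_ex; exists l. Qed.

Lemma has_sum_lim a l : has_sum a l -> limn (series a) = l.
Proof. by move/cvg_lim; apply. Qed.

Lemma cvg_has_sum a : cvgn (series a) -> has_sum a (limn (series a)).
Proof. by []. Qed.

Lemma has_sum_comparison a b (m : R) : (forall k, `|a k| <= b k) -> has_sum b m ->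
  exists2 l, has_sum a l & `|l| <= m.
Proof.
move=> ab bm.
have cn : cvgn [normed series a].
  apply: (series_le_cvg _ _ ab (has_sum_cvg bm)) => // k.
  exact: le_trans (ab k).
exists (limn (series a)); first exact/cvg_has_sum/normed_cvg.
apply: (le_trans (lim_series_norm cn)).
rewrite -(has_sum_lim bm); apply: lim_series_le => //.
exact: has_sum_cvg bm.
Qed.

Lemma has_sum_bounded_partial a M :
  (forall k, 0 <= a k) -> (forall n, series a n <= M) ->
  exists2 l, has_sum a l & l <= M.
Proof.
move=> a0 aM.
have ca : cvgn (series a).
  apply: nondecreasing_is_cvgn; first exact: nondecreasing_series.
  by exists M => _ [n _ <-].
exists (limn (series a)) => //.
by apply: limr_le => //; apply: nearW.
Qed.

(** Bridge to extended real series, where nonnegative double series may be reordered and where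
    expectations take their values. *)
Lemma has_sum_nneseries a l : (forall k, 0 <= a k) ->
  has_sum a l <-> (\sum_(k <oo) (a k)%:E = l%:E)%E.
Proof.
move=> a0; split=> [al|sl].
  rewrite -(has_sum_lim al) -EFin_lim; last exact: has_sum_cvg al.
  by congr (limn _); apply/funext => n; rewrite /series /= sumEFin.
have ca : cvgn (series a) by apply: nnseries_is_cvg => //; rewrite sl ltry.
suff <- : limn (series a) = l by [].
apply/EFin_inj; rewrite -sl -EFin_lim//.
by congr (limn _); apply/funext => n; rewrite /series /= sumEFin.
Qed.

(** Tonelli for series. Each column converges because its entries are dominated by the row sums. *)
Lemma has_sum_interchange_ge0 (a : nat -> R^nat) (s : R^nat) S :
  (forall m k, 0 <= a m k) -> (forall m, has_sum (a m) (s m)) -> has_sum s S ->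
  exists2 t : R^nat, (forall k, has_sum (a ^~ k) (t k)) & has_sum t S.
Proof.
move=> a0 as_ sS.
have s0 m : 0 <= s m by exact: has_sum_ge0 (as_ m).
have cvgk k : exists l, has_sum (a ^~ k) l.
  have [m|l ? _] := @has_sum_comparison (a ^~ k) s S _ sS; last by exists l.
  by rewrite ger0_norm// (has_sum_term_le k (a0 m) (as_ m)).
have [t tE] := choice cvgk.
have t0 k : 0 <= t k by apply: has_sum_ge0 (tE k) => m; exact: a0.
exists t => //; apply/has_sum_nneseries => //.
have : (\sum_(m <oo) (s m)%:E = S%:E)%E by apply/has_sum_nneseries.
under eq_eseriesr => m _.
  rewrite -(proj1 (has_sum_nneseries (s m) (a0 m)) (as_ m)); over.
rewrite nneseries_interchange; last by move=> i j; rewrite lee_fin.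
move=> <-; apply: eq_eseriesr => k _; apply/esym.
by apply/(has_sum_nneseries (t k)) => // m; exact: a0.
Qed.

(** Fubini from Tonelli: a = (a + b) - b is a difference of two nonnegative arrays, both with
    summable row sums. *)
Lemma has_sum_interchange (a b : nat -> R^nat) (s sb : R^nat) S Sb :
  (forall m k, `|a m k| <= b m k) ->
  (forall m, has_sum (b m) (sb m)) -> has_sum sb Sb ->
  (forall m, has_sum (a m) (s m)) -> has_sum s S ->
  exists2 t : R^nat, (forall k, has_sum (a ^~ k) (t k)) & has_sum t S.
Proof.
move=> ab bs sbS as_ sS.
have b0 m k : 0 <= b m k by apply: le_trans (ab m k).
have [t tb tS] := has_sum_interchange_ge0 b0 bs sbS.
have ab0 m k : 0 <= a m k + b m k.
  by have := ab m k; rewrite ler_norml => /andP[+ _]; rewrite -lerBlDr sub0r.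
have [t' tb' tS'] := has_sum_interchange_ge0 ab0
  (fun m => has_sumD (as_ m) (bs m)) (has_sumD sS sbS).
exists (fun k => t' k - t k) => [k|].
  by have /has_sum_ext := has_sumB (tb' k) (tb k); apply => m; rewrite addrK.
by have := has_sumB tS' tS; rewrite addrK.
Qed.

Lemma has_sum_cauchy (a b : R^nat) A B : (forall k, 0 <= a k) ->
  (forall k, 0 <= b k) -> has_sum a A -> has_sum b B ->
  has_sum (fun k => \sum_(i < k.+1) a i * b (k - i)%N) (A * B).
Proof.
move=> a0 b0 aA bB.
(* Row i is [a i * b] moved i places to the right. Column k then has finitely many nonzero entries,
   and they add up to the convolution at k. *)
pose f i k := if (k < i)%N then 0 else a i * b (k - i)%N.
have [|||t tE tS] := @has_sum_interchange_ge0 f (fun i => a i * B) (A * B).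
- by move=> i k; rewrite /f; case: ifP => // _; rewrite mulr_ge0.
- by move=> i; exact: (has_sum_shift i (has_sumZ (a i) bB)).
- rewrite mulrC; have /has_sum_ext := has_sumZ B aA; apply => i.
  by rewrite mulrC.
have /has_sum_ext := tS; apply => k; apply: (has_sum_unique (tE k)).
rewrite /has_sum; apply: cvg_near_cst; near=> n.
have kn : (k < n)%N by near: n; exact: nbhs_infty_gt.
rewrite /series/= (big_cat_nat (n := k.+1))//=.
rewrite [X in _ + X]big1_seq; last first.
  by move=> i; rewrite mem_index_iota /f => /andP[_ /andP[->]].
rewrite addr0 big_mkord; apply: eq_bigr => i _.
by rewrite /f ltnNge -ltnS ltn_ord.
Unshelve. all: by end_near. Qed.

(** Dominated convergence for series. Convergence of the limit series belongs to the conclusion, so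
    it need not be known beforehand; the majorant must hold for all m from one common N on. *)
Lemma has_sum_tannery (F : nat -> R^nat) (b l : R^nat) (B : R) (S : R^nat) :
  has_sum b B ->
  (\forall N \near \oo, forall m, `|F N m| <= b m) ->
  (forall m, F N m @[N --> \oo] --> l m) ->
  (\forall N \near \oo, has_sum (F N) (S N)) ->
  exists2 L, has_sum l L & S @ \oo --> L.
Proof.
move=> bB Fb Fl FS.
have lb m : `|l m| <= b m.
  rewrite -(cvg_lim _ (cvg_norm (Fl m)))//.
  apply: limr_le; first by apply/cvg_ex; exists (`|l m|); exact: cvg_norm.
  by apply: filterS Fb => N; apply.
have b0 m : 0 <= b m by apply: le_trans (lb m).
have [L lL _] := has_sum_comparison lb bB.
exists L => //; apply/cvgrPdist_le => e e0.
have e4 : 0 < e / 4 by rewrite divr_gt0.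
(* Past this k every series dominated by [b] has a tail of at most e / 4. The error then splits into
   two tails and the difference of the first k terms. *)
have [k kB] : exists k, B - series b k <= e / 4.
  have /cvgrPdist_le/(_ _ e4)[k _ /(_ k (leqnn k))] := bB.
  by move=> /(le_trans (ler_norm _)); exists k.
have tail (a : R^nat) A : has_sum a A -> (forall m, `|a m| <= b m) ->
    `|A - series a k| <= e / 4.
  move=> aA ab.
  have step (c : R^nat) C : has_sum c C ->
      has_sum (fun m => if (m < k)%N then 0 else c m) (C - series c k).
    move=> cC; rewrite /has_sum.
    have : (fun n => series c n - series c k) @ \oo --> C - series c k.
      by apply: cvgB => //; exact: cvg_cst.
    apply: cvg_trans; apply: near_eq_cvg; near=> n.
    have kn : (k <= n)%N by near: n; exact: nbhs_infty_ge.
    rewrite sub_series_geq// /series/= [RHS](big_cat_nat (n := k))//=.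
    rewrite [X in _ = X + _]big1_seq; last first.
      by move=> i; rewrite mem_index_iota => /andP[_ /andP[_ ->]].
    rewrite add0r !big_nat; apply: eq_bigr => i /andP[ki _].
    by rewrite ltnNge ki.
  have [m|l' h1 h2] := @has_sum_comparison
      (fun m => if (m < k)%N then 0 else a m) _ _ _ (step _ _ bB).
    by case: ifP => _; [rewrite normr0|exact: ab].
  by rewrite (has_sum_unique (step _ _ aA) h1) (le_trans h2).
have sF : (fun N => series (F N) k) @ \oo --> series l k.
  by rewrite /series/=; apply: (@cvg_big _ _ _ _ _ add_continuous) => m _; exact: Fl.
have /cvgrPdist_le/(_ _ e4) nF := sF.
near=> N.
have h1 := tail _ _ lL lb.
have h2 : `|S N - series (F N) k| <= e / 4.
  by apply: tail; near: N.
have h3 : `|series l k - series (F N) k| <= e / 4 by near: N.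
rewrite (_ : L - S N = (L - series l k) + (series l k - series (F N) k)
   - (S N - series (F N) k)); last by ring.
apply: (le_trans (ler_normB _ _)).
apply: (le_trans (lerD (ler_normD _ _) (lexx _))).
lra.
Unshelve. all: by end_near. Qed.

(** Terms at r / 2 are bounded by some M, so at th * r / 2 everything after the constant term is at
    most M th / (1 - th), which is arbitrarily small. *)
Lemma powerseries_eq0_head (r : R) (d : R^nat) : 0 < r ->
  (forall u : R, 0 < u < r -> has_sum (fun k => d k * u ^+ k) 0) -> d 0%N = 0.
Proof.
move=> r0 d0.
have r2 : 0 < r / 2 < r by rewrite divr_gt0//= gtr_pMr// invf_lt1// ltr1n.
have r20 : 0 < r / 2 by case/andP: r2.
have [M M0 dM] : exists2 M : R, 0 < M & forall k, `|d k * (r / 2) ^+ k| <= M.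
  have [M [_ /(_ (`|M| + 1))]] :=
    cvg_series_bounded (has_sum_cvg (d0 _ r2)).
  rewrite (le_lt_trans (ler_norm M)) ?ltrDl// => /(_ isT) dM.
  by exists (`|M| + 1) => [|k]; [rewrite ltr_wpDl|exact: dM].
have key (th : R) : 0 < th < 1 -> `|d 0%N| <= M * (th / (1 - th)).
  move=> /andP[th0 th1].
  have thr : 0 < th * (r / 2) < r.
    rewrite mulr_gt0//=; case/andP: r2 => _; apply: le_lt_trans.
    by rewrite ler_piMl// ltW.
  have := has_sum_behead (d0 _ thr); rewrite expr0 mulr1 sub0r => h.
  have nth : `|th| < 1 by rewrite gtr0_norm.
  have g : has_sum (fun k => M * th * th ^+ k) (M * th / (1 - th)).
    exact: cvg_geometric_series.
  have [k|l hl] := @has_sum_comparison (fun k => d k.+1 * (th * (r / 2)) ^+ k.+1)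
    _ _ _ g; last first.
    by rewrite (has_sum_unique hl h) normrN mulrA.
  rewrite exprMn mulrCA -mulrA -exprS normrM (gtr0_norm (exprn_gt0 _ th0)).
  by rewrite mulrC ler_wpM2r// exprn_ge0// ltW.
apply/normr0_eq0/eqP; rewrite eq_le normr_ge0 andbT.
apply/ler_addgt0Pl => e e0; rewrite addr0.
have Me : 0 < M + e by rewrite addr_gt0.
(* th = e / (M + e) is the solution of M th / (1 - th) = e. *)
have -> : e = M * ((e / (M + e)) / (1 - e / (M + e))).
  by field; rewrite addrK !gt_eqF.
apply: key; rewrite divr_gt0//= ltr_pdivrMr// mul1r.
by rewrite ltrDr.
Qed.

Lemma powerseries_eq0 (r : R) (d : R^nat) : 0 < r ->
  (forall u : R, 0 < u < r -> has_sum (fun k => d k * u ^+ k) 0) ->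
  forall k, d k = 0.
Proof.
move=> r0 + k; elim: k d => [|k IH] d d0; first exact: powerseries_eq0_head d0.
apply: (IH (fun k => d k.+1)) => u ur.
have u0 : u != 0 by case/andP: ur => /gt_eqF ->.
have := has_sumZ u^-1 (has_sum_behead (d0 u ur)).
rewrite (powerseries_eq0_head r0 d0) mul0r subr0 mulr0.
by move=> /has_sum_ext; apply => j; rewrite exprS mulrCA mulKf.
Qed.

End has_sum.

Arguments has_sumZ {R a l} c _.
Arguments has_sum_shift {R a l} n _.

(** * The binomial series *)

Lemma gt0_powRD {R : realType} (x r s : R) :
  0 < x -> x `^ (r + s) = x `^ r * x `^ s.
Proof. by move=> x0; rewrite powRD// (gt_eqF x0) implybT. Qed.

(* The coefficient of u ^ k in (1 - u) ^ (- c). *)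
HB.lock Definition negbin {R : realType} (c : R) (k : nat) : R :=
  pochhammer c k / k`!%:R.

Section negative_binomial.
Context {R : realType}.
Implicit Types (c u x y : R) (k m n : nat).

Lemma pochhammer0 c : pochhammer c 0 = 1.
Proof. by rewrite /pochhammer big_ord0. Qed.

Lemma pochhammerS c m : pochhammer c m.+1 = pochhammer c m * (c + m%:R).
Proof. by rewrite /pochhammer big_ord_recr. Qed.

Lemma pochhammerSl c m : pochhammer c m.+1 = c * pochhammer (c + 1) m.
Proof.
rewrite /pochhammer big_ord_recl addr0; congr (_ * _).
by apply: eq_bigr => i _; rewrite -addrA -natr1 (addrC 1).
Qed.

Lemma pochhammer_ge0 c m : 0 <= c -> 0 <= pochhammer c m.
Proof. by move=> c0; apply: prodr_ge0 => i _; rewrite addr_ge0. Qed.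

Lemma negbinE c k : negbin c k = pochhammer c k / k`!%:R.
Proof. by rewrite negbin.unlock. Qed.

Lemma negbin0 c : negbin c 0 = 1.
Proof. by rewrite !negbinE pochhammer0 divr1. Qed.

Lemma negbin_ge0 c k : 0 <= c -> 0 <= negbin c k.
Proof. by move=> c0; rewrite negbinE divr_ge0// pochhammer_ge0. Qed.

Lemma negbinS c k : k.+1%:R * negbin c k.+1 = (c + k%:R) * negbin c k.
Proof.
rewrite !negbinE pochhammerS factS natrM; field.
by rewrite pnatr_eq0 -lt0n fact_gt0 addrC natr1 pnatr_eq0.
Qed.

Lemma negbinSl c k : k.+1%:R * negbin c k.+1 = c * negbin (c + 1) k.
Proof.
rewrite !negbinE pochhammerSl factS natrM; field.
by rewrite pnatr_eq0 -lt0n fact_gt0 addrC natr1 pnatr_eq0.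
Qed.

(** Multiplying (1 - u) ^ (- c) by 1 / (1 - u) sums its coefficients and raises c by one. *)
Lemma sum_negbin c n : \sum_(i < n.+1) negbin c i = negbin (c + 1) n.
Proof.
elim: n => [|n IH]; first by rewrite big_ord1 !negbin0.
rewrite big_ord_recr IH/=; apply: (@mulfI _ n.+1%:R); first by rewrite pnatr_eq0.
rewrite mulrDr negbinSl negbinS -natr1; ring.
Qed.

(** Truncated binomial series times (1 - u) ^ c. The series has the right sum exactly when this
    product tends to 1, its value at u = 0. *)
Let f c n u : R := (\sum_(i < n) negbin c i * u ^+ i) * (1 - u) `^ c.

Let df c n u : R := - (n.+1%:R * negbin c n.+1 * u ^+ n * (1 - u) `^ (c - 1)).

(** The derivative telescopes to one term: by [negbinS], each added summand cancels the previous
    remainder and leaves the next one. This makes the mean value theorem effective. *)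
Let is_derive_f c n u : 0 < c -> u < 1 -> is_derive u 1 (f c n.+1) (df c n u).
Proof.
rewrite /df => c0 u1; have u1' : 0 < 1 - u by rewrite subr_gt0.
have dp : is_derive u 1 (fun y : R => (1 - y) `^ c) (- (c * (1 - u) `^ (c - 1))).
  have h := @is_derive1_powR R c _ u1'.
  have g : is_derive u 1 (fun y : R => 1 - y) (- 1).
    have := is_deriveB (is_derive_cst (1 : R) u 1) (is_derive_id u (1 : R)).
    by rewrite sub0r.
  have := @is_derive1_comp _ (fun y => y `^ c) (fun y => 1 - y) u _ _ h g.
  by rewrite mulrN1.
elim: n => [|n IH].
  rewrite (_ : f c 1 = fun y => (1 - y) `^ c).
    by rewrite negbinSl negbin0 !mulr1.
  by apply/funext => y; rewrite /f big_ord1 negbin0 !mul1r.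
have -> : f c n.+2 = f c n.+1 +
    negbin c n.+1 \*: ((id : R -> R) ^+ n.+1 * (fun y => (1 - y) `^ c)).
  apply/funext => y; rewrite /f fctE big_ord_recr mulrDl -mulrA /=.
  by rewrite exprfctE.
have := is_deriveD IH (is_deriveZ (negbin c n.+1)
  (is_deriveM (is_deriveX n.+1 (is_derive_id u (1 : R))) dp)).
move/is_derive_eq; apply.
rewrite /= exprfctE [in RHS]negbinS -(mulr_powRB1 (ltW u1') c0) !exprS /=.
rewrite /GRing.scale/=.
set p := _ `^ _; set q := u ^+ n; set a := negbin _ _.
ring.
Qed.

Let continuous_f c n x y : 0 < c -> y < 1 ->
  {within `[x, y], continuous f c n.+1}.
Proof.
move=> c0 y1; apply: derivable_within_continuous => z.
rewrite in_itv/= => /andP[_ zy].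
by have [] := is_derive_f n c0 (le_lt_trans zy y1).
Qed.

Let f0 c n : f c n.+1 0 = 1.
Proof.
rewrite /f subr0 powR1 mulr1 big_ord_recl negbin0 mulr1 big1 ?addr0// => i _.
by rewrite exprS mul0r mulr0.
Qed.

(** [f] equals 1 at 0, and its derivative is nonpositive for u >= 0. *)
Let f_le1 c n u : 0 < c -> 0 <= u -> u < 1 -> f c n.+1 u <= 1.
Proof.
move=> c0 u0 u1; have [z|z] :=
  MVT_segment (df := df c n) u0 _ (@continuous_f c n _ _ c0 u1).
  by rewrite in_itv/= => /andP[_ zu]; apply: is_derive_f c0 (lt_trans zu u1).
rewrite in_itv/= => /andP[z0 zu]; rewrite f0 => /eqP.
rewrite subr_eq => /eqP ->; rewrite /df gerDr subr0 mulNr oppr_le0.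
by rewrite !mulr_ge0 ?exprn_ge0 ?negbin_ge0 ?powR_ge0// ltW.
Qed.

Lemma sum_negbin_le c n u : 0 < c -> 0 <= u -> u < 1 ->
  \sum_(i < n) negbin c i * u ^+ i <= (1 - u) `^ (- c).
Proof.
move=> c0 u0 u1; have p0 : 0 < (1 - u) `^ c by rewrite powR_gt0// subr_gt0.
rewrite powRN -[leRHS]mul1r ler_pdivlMr//.
apply: le_trans (f_le1 n c0 u0 u1); rewrite ler_pM2r// big_ord_recr/= lerDl.
by rewrite mulr_ge0 ?exprn_ge0// negbin_ge0// ltW.
Qed.

(** Bounded partial sums at [|u|] force the terms to 0. Used with c + 1, this makes the mean-value
    remainder of [f] vanish for either sign of u. *)
Let negbin_cvg0 c u : 0 < c -> `|u| < 1 ->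
  (fun n => negbin c n * `|u| ^+ n) @ \oo --> 0.
Proof.
move=> c0 u1; apply: cvg_series_cvg_0.
have [||l + _] := @has_sum_bounded_partial R (fun n => negbin c n * `|u| ^+ n)
    ((1 - `|u|) `^ (- c)); last exact: has_sum_cvg.
  by move=> n; rewrite mulr_ge0 ?exprn_ge0// negbin_ge0// ltW.
by move=> n; rewrite /series/= big_mkord sum_negbin_le.
Qed.

Let f_near1 c n u : 0 < c -> `|u| < 1 ->
  `|f c n.+1 u - 1| <= c * 2 `^ c / (1 - `|u|) * (negbin (c + 1) n * `|u| ^+ n).
Proof.
move=> c0 u1; have c0' := ltW c0.
have c1 : 0 <= c + 1 by rewrite addr_ge0.
have u11 : u < 1 by exact: le_lt_trans (ler_norm u) u1.
have bound (z : R) : `|z| <= `|u| ->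
    `|(n.+1%:R * negbin c n.+1 * z ^+ n * (1 - z) `^ (c - 1)) * u| <=
    c * 2 `^ c / (1 - `|u|) * (negbin (c + 1) n * `|u| ^+ n).
  move=> zu; have z1 : `|z| < 1 by exact: le_lt_trans zu u1.
  have z11 : 0 < 1 - z by rewrite subr_gt0 (le_lt_trans (ler_norm z)).
  rewrite negbinSl.
  (* The sign of c - 1 is unknown, so the power is split: (1 - z) ^ c is at most 2 ^ c, and 1 / (1 -
     z) is at most 1 / (1 - |u|). *)
  have -> : (1 - z) `^ (c - 1) = (1 - z) `^ c / (1 - z).
    by rewrite -(mulr_powRB1 (ltW z11) c0) mulrC mulKf// gt_eqF.
  rewrite !normrM normrX normfV (gtr0_norm c0) (gtr0_norm z11).
  rewrite (ger0_norm (powR_ge0 _ _)) ger0_norm ?negbin_ge0//.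
  rewrite (_ : c * 2 `^ c / (1 - `|u|) * (negbin (c + 1) n * `|u| ^+ n) =
    c * negbin (c + 1) n * `|u| ^+ n *
     (2 `^ c / (1 - `|u|))); last by ring.
  rewrite -[leRHS]mulr1; apply: ler_pM => //; last exact: ltW.
    by rewrite !mulr_ge0 ?exprn_ge0 ?negbin_ge0 ?powR_ge0 ?invr_ge0// ltW.
  apply: ler_pM => //.
  - by rewrite !mulr_ge0 ?exprn_ge0 ?negbin_ge0.
  - by rewrite mulr_ge0 ?powR_ge0// invr_ge0 ltW.
  - rewrite ler_wpM2l ?mulr_ge0 ?negbin_ge0//.
    by rewrite lerXn2r// nnegrE.
  - apply: ler_pM; rewrite ?powR_ge0 ?invr_ge0 ?(ltW z11)//.
    + apply: ge0_ler_powR; rewrite ?nnegrE ?(ltW z11)//.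
      by move: z1; rewrite ltr_norml => /andP[]; lra.
    + have h : 1 - `|u| <= 1 - z.
        by rewrite lerD2l lerN2 (le_trans (ler_norm z)).
      by rewrite lef_pV2 ?posrE// subr_gt0.
have [u0|u0] := leP 0 u.
  have [z|z] :=
  MVT_segment (df := df c n) u0 _ (@continuous_f c n _ _ c0 u11).
    by rewrite in_itv/= => /andP[_ zu]; apply: is_derive_f c0 (lt_trans zu u11).
  rewrite in_itv/= f0 subr0 /df => /andP[z0 zu] ->.
  by rewrite mulNr normrN bound// !ger0_norm.
have [z|z] :=
  MVT_segment (df := df c n) (ltW u0) _ (@continuous_f c n _ _ c0 (@ltr01 R)).
  rewrite in_itv/= => /andP[_ z0].
  by apply: is_derive_f c0 (lt_trans z0 (@ltr01 R)).
rewrite in_itv/= f0 sub0r distrC /df => /andP[uz z0] ->.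
by rewrite mulrNN bound// !ler0_norm ?lerN2 ?(ltW u0)//.
Qed.

Lemma has_sum_negbin c u : 0 < c -> `|u| < 1 ->
  has_sum (fun k => negbin c k * u ^+ k) ((1 - u) `^ (- c)).
Proof.
move=> c0 u1.
have u11 : 0 < 1 - u by rewrite subr_gt0 (le_lt_trans (ler_norm u)).
have fc : (fun n => f c n.+1 u) @ \oo --> (1 : R).
  apply/cvgrPdistC_le => e e0.
  have c10 : 0 < c + 1 by rewrite addr_gt0.
  have : (fun n => c * 2 `^ c / (1 - `|u|) * (negbin (c + 1) n * `|u| ^+ n))
      @ \oo --> c * 2 `^ c / (1 - `|u|) * 0.
    by apply: cvgM; [exact: cvg_cst|exact: negbin_cvg0].
  rewrite mulr0 => /cvgrPdistC_le/(_ _ e0); apply: filterS => n.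
  rewrite subr0 => h; apply: le_trans (f_near1 n c0 u1) (le_trans (ler_norm _) h).
rewrite /has_sum -cvg_shiftS /=.
have : (fun n => f c n.+1 u * (1 - u) `^ (- c)) @ \oo --> 1 * (1 - u) `^ (- c).
  by apply: cvgM => //; exact: cvg_cst.
rewrite mul1r.
apply: cvg_trans; apply: near_eq_cvg; near=> n.
by rewrite /series/= big_mkord /f powRN mulfK// gt_eqF// powR_gt0.
Unshelve. all: by end_near. Qed.

(** By [sum_negbin] the left side is the sum of the first n + 1 coefficients of (1 - u) ^ (- c);
    weighting the i-th by u ^ i >= u ^ n costs at most the factor u ^ (- n). *)
Lemma negbin1_le c n u : 0 < c -> 0 < u < 1 ->
  negbin (c + 1) n <= u ^- n * (1 - u) `^ (- c).
Proof.
move=> c0 /andP[u0 u1]; rewrite mulrC ler_pdivlMr ?exprn_gt0//.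
apply: le_trans (sum_negbin_le n.+1 c0 (ltW u0) u1).
rewrite -sum_negbin mulr_suml; apply: ler_sum => i _.
rewrite ler_wpM2l ?negbin_ge0 ?(ltW c0)//.
by rewrite ler_wiXn2l ?(ltW u0) ?(ltW u1)// -ltnS.
Qed.

End negative_binomial.

(** * Partial sums of independent variables *)

Fixpoint convpow {R : realType} (p : nat -> R) (n k : nat) : R :=
  if n is m.+1 then \sum_(i < k.+1) convpow p m i * p (k - i)%N
  else (k == 0)%:R.

Definition convcdf {R : realType} (p : nat -> R) (n t : nat) : R :=
  \sum_(k < t.+1) convpow p n k.

Lemma convpow_ge0 {R : realType} (p : nat -> R) (n k : nat) :
  (forall j, 0 <= p j) -> 0 <= convpow p n k.
Proof.
move=> p0; elim: n k => [|n IH] k /=; first by case: (k == 0%N).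
by apply: sumr_ge0 => i _; rewrite mulr_ge0.
Qed.

Section renewal.
Context {d : measure_display} {T : measurableType d} {R : realType}.
Variables (P : probability T R) (Z : nat -> {RV P >-> nat}).

Definition interarrival_pmf (k : nat) : R := fine (P (Z 0%N @^-1` [set k])).
Local Notation p := interarrival_pmf.
Local Notation q := (convpow p).

Lemma interarrival_pmf_ge0 k : 0 <= p k.
Proof. by rewrite fine_ge0. Qed.

Let mZ j (B : set nat) : measurable (Z j @^-1` B).
Proof. by rewrite -[X in measurable X]setTI; apply: (measurable_funP (Z j)). Qed.

Let measurable_arrival n : measurable_fun [set: T] (arrival Z n).
Proof.
elim: n => [|n IH].
  rewrite (_ : arrival Z 0 = cst 0%N); first exact: measurable_cst.
  by apply/funext => w; rewrite /arrival big_ord0.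
rewrite (_ : arrival Z n.+1 = fun w => (arrival Z n w + Z n w)%N).
  by apply: measurable_fun_addn.
by apply/funext => w; rewrite /arrival big_ord_recr.
Qed.

Let mJ n (B : set nat) : measurable (arrival Z n @^-1` B).
Proof. by rewrite -[X in measurable X]setTI; apply: measurable_arrival. Qed.

Hypothesis independent : mutually_independent Z.
Hypothesis identical : identically_distributed Z.

Let Zp j k : P (Z j @^-1` [set k]) = (p k)%:E.
Proof. by rewrite (identical j 0%N)// fineK// fin_num_measure. Qed.

(* Conditioning on finitely many later interarrival times is what makes the
   induction on n go through. *)
Let arrival_independent n k (I : {fset nat}) (B : nat -> set nat) :
  (forall j, j \in I -> (n <= j)%N) ->
  P (arrival Z n @^-1` [set k] `&` \bigcap_(j in [set` I]) (Z j @^-1` B j)) =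
  ((q n k)%:E * \prod_(j <- I) P (Z j @^-1` B j))%E.
Proof.
elim: n k I B => [|n IH] k I B nI.
  rewrite /= (_ : arrival Z 0 @^-1` [set k] = if k == 0%N then setT else set0).
    by case: eqP => _; [rewrite setTI independent// mul1e|rewrite set0I measure0 mul0e].
  apply/seteqP; split => w /=; rewrite /arrival big_ord0.
    by move=> <-.
  by case: eqP => // ->.
have nIn : n \notin I by apply/negP => /nI; rewrite ltnn.
(* The event is split by the value i of J_n. On each piece the next interarrival time must equal k -
   i, and this becomes one more constraint, at index n, for the induction hypothesis. *)
pose B' i j := if j == n then [set (k - i)%N] else B j.
pose F i := arrival Z n @^-1` [set i] `&`
  \bigcap_(j in [set` (n |` I)%fset]) (Z j @^-1` B' i j).
have -> : arrival Z n.+1 @^-1` [set k] `&` \bigcap_(j in [set` I]) (Z j @^-1` B j) =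
    \big[setU/set0]_(i < k.+1) F i.
  rewrite -bigcup_mkord; apply/seteqP; split => w /=.
    rewrite /arrival big_ord_recr/= -/(arrival Z n w) => -[Jk BI].
    exists (arrival Z n w); first by rewrite /= ltnS -Jk leq_addr.
    split=> // j; rewrite /= in_fset1U /B'; case: eqP => /= [-> _|_ jI].
      by rewrite -Jk addKn.
    exact: BI.
  case=> i /=; rewrite ltnS => ik [Ji BI]; split.
    have := BI n; rewrite /= in_fset1U eqxx /B' eqxx => /(_ isT) Zn.
    by rewrite /arrival big_ord_recr/= -/(arrival Z n w) Ji Zn subnKC.
  move=> j jI; have := BI j; rewrite /= in_fset1U jI orbT /B' => /(_ isT).
  by case: eqP => // jn; move: nIn; rewrite -jn jI.
have mF i : measurable (F i).
  apply: measurableI; first exact: mJ.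
  by apply: fin_bigcap_measurable => // j _; exact: mZ.
rewrite measure_semi_additive_ord_I//; last 2 first.
- apply/trivIsetP => i j _ _ /eqP ij; apply/seteqP; split => // w [[/= Ji _] [/= Jj _]].
  by case: ij; rewrite -Ji.
- by apply: bigsetU_measurable => i _; exact: mF.
rewrite /= -sumEFin ge0_sume_distrl; last first.
  by move=> i _; rewrite lee_fin mulr_ge0 ?interarrival_pmf_ge0// convpow_ge0// => j;
     exact: interarrival_pmf_ge0.
apply: eq_bigr => i _; rewrite /F IH; last first.
  by move=> j; rewrite in_fset1U => /orP[/eqP ->//|/nI/ltnW].
rewrite big_fsetU1//= /B' eqxx Zp EFinM muleA; congr (_ * _)%E.
rewrite !big_seq; apply: eq_bigr => j jI.
by case: eqP => // jn; move: nIn; rewrite -jn jI.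
Qed.

Lemma arrival_pmf n k : P (arrival Z n @^-1` [set k]) = (q n k)%:E.
Proof.
have := @arrival_independent n k fset0 (fun=> setT).
rewrite big_seq_fset0 mule1 => <-//.
by rewrite set_fset0 bigcap_set0 setIT.
Qed.

Lemma arrival_cdf n t :
  P [set w | (arrival Z n w <= t)%N] = (convcdf p n t)%:E.
Proof.
rewrite (_ : [set w | _] =
    \big[setU/set0]_(i < t.+1) (arrival Z n @^-1` [set (i : nat)])).
  rewrite (measure_semi_additive_ord_I _ (F := fun i => arrival Z n @^-1` [set i]))//.
  - by rewrite -sumEFin; apply: eq_bigr => i _; rewrite -arrival_pmf.
  - move=> i j _ _ [w [/= <- <-]] //.
  - by apply: bigsetU_measurable => i _; exact: mJ.
rewrite -(bigcup_mkord _ (fun i => arrival Z n @^-1` [set i])).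
apply/seteqP; split => w /=; first by exists (arrival Z n w).
by case=> i /= ? ->.
Qed.

Hypothesis positive : forall j w, (0 < Z j w)%N.

Let arrival_ge n w : (n <= arrival Z n w)%N.
Proof.
elim: n => // n IH; rewrite /arrival big_ord_recr/= -addn1 leq_add//.
Qed.

Lemma convcdf0 n t : (t < n)%N -> convcdf p n t = 0.
Proof.
move=> tn; apply/EFin_inj; rewrite -arrival_cdf.
rewrite (_ : [set w | _] = set0) ?measure0//.
apply/seteqP; split => // w /=; rewrite leqNgt => /negP; apply.
exact: leq_trans (arrival_ge n w).
Qed.

Lemma state_probE n t :
  state_prob Z n t = (convcdf p n t - convcdf p n.+1 t)%:E.
Proof.
rewrite EFinB -!arrival_cdf /state_prob.
rewrite (_ : [set w | _] = [set w | (arrival Z n w <= t)%N] `\`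
    [set w | (arrival Z n.+1 w <= t)%N]).
  rewrite measureD; [|exact: (mJ _ [set k | (k <= t)%N])..|].
    congr (_ - P _)%E; apply/setIidPr => w /=; apply: leq_trans.
    by rewrite /arrival [leqRHS]big_ord_recr leq_addr.
  by rewrite ltey_eq fin_num_measure//; exact: (mJ _ [set k | (k <= t)%N]).
apply/seteqP; split => w /=.
  by move=> /andP[-> tJ]; split => //; apply/negP; rewrite -ltnNge.
by move=> [-> /negP]; rewrite -ltnNge => ->.
Qed.

Lemma mean_arrivalsE t :
  mean_arrivals Z t = (\sum_(1 <= n < t.+1) convcdf p n t)%:E.
Proof.
(* Summation by parts. The boundary term vanishes as soon as N > t, since J_N >= N. *)
have sumE N : \sum_(0 <= n < N) n%:R * (convcdf p n t - convcdf p n.+1 t) =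
    \sum_(1 <= n < N.+1) convcdf p n t - N%:R * convcdf p N t.
  elim: N => [|N IH]; first by rewrite !big_geq// mul0r subr0.
  rewrite big_nat_recr//= IH [in RHS]big_nat_recr//= -natr1; ring.
apply: lim_near_cst => //; near=> N.
have tN : (t < N)%N by near: N; exact: nbhs_infty_gt.
under eq_bigr do rewrite state_probE -EFinM.
rewrite sumEFin sumE convcdf0// mulr0 subr0; congr EFin.
rewrite (big_cat_nat (n := t.+1))//=; last exact: leqW.
rewrite [X in _ + X]big1_seq ?addr0// => n.
by rewrite mem_index_iota => /andP[_ /andP[tn _]]; rewrite convcdf0.
Unshelve. all: by end_near. Qed.

(** For real u the real part of u ^ Z is u ^ Z itself, and its expectation splits over the level
    sets of [Z 0]. *)
Lemma interarrival_pgf (u g : R) : 0 <= u -> u <= 1 -> 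
  pgf_at Z 0 (u%:C)%C (g%:C)%C -> has_sum (fun k => p k * u ^+ k) g.
Proof.
move=> u0 u1 [+ _]; rewrite expectation.unlock /= => Eu.
apply/has_sum_nneseries => [k|].
  by rewrite mulr_ge0 ?interarrival_pmf_ge0// exprn_ge0.
rewrite -Eu.
have -> : [set: T] = \bigcup_k (Z 0%N @^-1` [set k]).
  by apply/seteqP; split => // w _; exists (Z 0%N w).
have ReE k : complex.Re ((u%:C)%C ^+ k) = u ^+ k by rewrite -rmorphXn.
rewrite ge0_integral_bigcup//=; last 3 first.
- apply/measurable_EFinP.
  rewrite (_ : (fun x => _) = (fun k : nat => u ^+ k) \o Z 0%N); last first.
    by apply/funext => w; exact: ReE.
  apply: (measurableT_comp (f := fun k : nat => u ^+ k)) => //.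
  exact: measurable_funTS.
- by move=> w _; rewrite lee_fin; move: (exprn_ge0 (Z 0%N w) u0); rewrite -ReE.
- by move=> i j _ _ [w [/= <- <-]].
apply: eq_eseriesr => k _.
rewrite (eq_integral (cst (u ^+ k)%:E)); last first.
  by move=> w; rewrite inE /= => ->; congr EFin; exact: ReE.
by rewrite integral_cst// EFinM muleC; congr (_ * _)%E; exact/esym/Zp.
Qed.

End renewal.

(** * Generating functions *)

Lemma convpow_has_sum {R : realType} (p : nat -> R) (n : nat) (u g : R) :
  (forall k, 0 <= p k) -> 0 <= u -> has_sum (fun k => p k * u ^+ k) g ->
  has_sum (fun k => convpow p n k * u ^+ k) (g ^+ n).
Proof.
move=> p0 u0 pg; elim: n => [|n IH].
  rewrite expr0 /has_sum -cvg_shiftS /=; apply: cvg_near_cst; near=> n.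
  rewrite /series/= big_nat_recl//= mul1r expr0 big1 ?addr0// => i _.
  by rewrite mul0r.
have q0 k : 0 <= convpow p n k * u ^+ k.
  by rewrite mulr_ge0 ?exprn_ge0// convpow_ge0.
have p0' k : 0 <= p k * u ^+ k by rewrite mulr_ge0 ?exprn_ge0.
have /has_sum_ext := has_sum_cauchy q0 p0' IH pg; rewrite exprSr; apply => k /=.
rewrite mulr_suml; apply: eq_bigr => i _.
by rewrite mulrACA -exprD subnKC// -ltnS.
Unshelve. all: by end_near. Qed.
Arguments convpow_has_sum {R p} n {u g}.

(** Passing from point masses to the distribution function is a Cauchy product with the geometric
    series. *)
Lemma convcdf_has_sum {R : realType} (p : nat -> R) (n : nat) (u g : R) :
  (forall k, 0 <= p k) -> 0 <= u -> u < 1 ->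
  has_sum (fun k => p k * u ^+ k) g ->
  has_sum (fun t => convcdf p n t * u ^+ t) (g ^+ n / (1 - u)).
Proof.
move=> p0 u0 u1 pg.
have q0 k : 0 <= convpow p n k * u ^+ k.
  by rewrite mulr_ge0 ?exprn_ge0// convpow_ge0.
have g1 : has_sum (fun k => u ^+ k) (1 - u)^-1.
  have nu1 : `|u| < 1 by rewrite ger0_norm.
  have := @cvg_geometric_series R 1 u nu1; rewrite div1r.
  by move/has_sum_ext; apply => k; rewrite /= mul1r.
have u0' k : 0 <= u ^+ k by rewrite exprn_ge0.
have /has_sum_ext := has_sum_cauchy q0 u0' (convpow_has_sum n p0 u0 pg) g1.
apply => k; rewrite /convcdf mulr_suml; apply: eq_bigr => i _.
by rewrite -mulrA -exprD subnKC// -ltnS.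
Qed.
Arguments convcdf_has_sum {R p} n {u g}.

Section pdtp_cdf.
Context {R : realType}.
Variables (alpha nu xi : R) (n : nat) (p : nat -> R).
Hypotheses (alpha0 : 0 < alpha) (nu0 : 0 < nu) (xi0 : 0 < xi) (xi1 : xi < 1).
Hypotheses (n0 : (0 < n)%N) (p0 : forall k, 0 <= p k).
Hypothesis pgf : forall u : R, 0 <= u < 1 ->
  has_sum (fun k => p k * u ^+ k)
    (xi `^ nu * u / (xi + (1 - u) `^ alpha) `^ nu).

(** The m-th term of the expansion of P(J_n <= n + k). The time is counted from n because the
    generating function carries the factor u ^ n. *)
Definition pdtp_cdf_term (k m : nat) : R :=
  (-1) ^+ m * (xi `^ (nu * n%:R + m%:R) * negbin (n%:R * nu) m *
    negbin (alpha * (m%:R + n%:R * nu) + 1) k).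

Let c : R := n%:R * nu.
Let c0 : 0 < c. Proof. by rewrite mulr_gt0// ltr0n. Qed.

(* For 0 < u < r one has xi < (1 - u) ^ alpha, so that the binomial series of
   (xi + (1 - u) ^ alpha) ^ (- c) in powers of xi / (1 - u) ^ alpha converges. *)
Let r : R := 1 - xi `^ alpha^-1.

Let r0 : 0 < r.
Proof.
rewrite subr_gt0.
have a0 : 0 < alpha^-1 by rewrite invr_gt0.
have := gt0_ltr_powR a0 _ _ xi1; rewrite powR1; apply; rewrite nnegrE//.
exact: ltW.
Qed.

Let xi_lt (u : R) : 0 < u < r -> xi < (1 - u) `^ alpha.
Proof.
move=> /andP[u0 ur]; have h : xi `^ alpha^-1 < 1 - u by move: ur; rewrite /r; lra.
rewrite (_ : xi = (xi `^ alpha^-1) `^ alpha); last first.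
  by rewrite -powRrM mulVf ?gt_eqF// powRr1// ltW.
have h0 : 0 <= 1 - u by exact: le_trans (powR_ge0 _ _) (ltW h).
by apply: (gt0_ltr_powR alpha0 _ _ h); rewrite nnegrE ?powR_ge0.
Qed.

Let u_lt1 (u : R) : 0 < u < r -> u < 1.
Proof.
by move=> /andP[_ /lt_trans]; apply; rewrite gtrDl oppr_lt0 powR_gt0.
Qed.

(** Row m of the double series without its sign: a binomial series in u with exponent - (alpha (m +
    n nu) + 1). What remains in m is a binomial series in xi / (1 - u) ^ alpha. *)
Let inner m (u : R) : 0 < u < r ->
  has_sum (fun k => xi `^ (nu * n%:R + m%:R) * negbin (n%:R * nu) m *
    negbin (alpha * (m%:R + n%:R * nu) + 1) k * u ^+ k)
  (xi `^ c * (1 - u) `^ (- (alpha * c + 1)) *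
    (negbin c m * (xi / (1 - u) `^ alpha) ^+ m)).
Proof.
move=> ur; have u1 := u_lt1 ur; have v0 : 0 < 1 - u by rewrite subr_gt0.
have c'0 : 0 < alpha * (m%:R + c) + 1.
  by rewrite ltr_wpDl// mulr_ge0// ?addr_ge0// ltW.
have nu1 : `|u| < 1 by rewrite gtr0_norm//; case/andP: ur.
have := has_sumZ (xi `^ (nu * n%:R + m%:R) * negbin c m) (has_sum_negbin c'0 nu1).
rewrite (_ : _ * _ * _ `^ _ = xi `^ c * (1 - u) `^ (- (alpha * c + 1)) *
    (negbin c m * (xi / (1 - u) `^ alpha) ^+ m)).
  by move/has_sum_ext; apply => k; rewrite mulrA.
have -> : - (alpha * (m%:R + c) + 1) = - (alpha * c + 1) + - (alpha * m%:R) by ring.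
rewrite gt0_powRD// gt0_powRD//.
rewrite [in RHS]exprMn exprVn -(powR_mulrn m (powR_ge0 (1-u) alpha)) -powRrM.
rewrite -(powR_mulrn m (ltW xi0)) powRN (mulrC nu) -/c powRN; ring.
Qed.

Lemma convcdf_pdtp k : has_sum (pdtp_cdf_term k) (convcdf p n (n + k)).
Proof.
have interchange (u : R) : 0 < u < r -> exists2 t : R^nat,
    forall k, has_sum (fun m => pdtp_cdf_term k m * u ^+ k) (t k) &
    has_sum t ((xi `^ nu / (xi + (1 - u) `^ alpha) `^ nu) ^+ n / (1 - u)).
  move=> ur; have u1 := u_lt1 ur; have v0 : 0 < 1 - u by rewrite subr_gt0.
  have va0 : 0 < (1 - u) `^ alpha by rewrite powR_gt0.
  have u0 : 0 <= u by case/andP: ur => /ltW.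
  have y0 : 0 < xi / (1 - u) `^ alpha by rewrite divr_gt0.
  have y1 : `|xi / (1 - u) `^ alpha| < 1.
    by rewrite gtr0_norm// ltr_pdivrMr// mul1r xi_lt.
  have y1' : `|- (xi / (1 - u) `^ alpha)| < 1 by rewrite normrN.
  set A := xi `^ c * (1 - u) `^ (- (alpha * c + 1)).
  have sgn m x : `|(-1) ^+ m * x| = `|x| :> R.
    by rewrite normrM normrX normrN1 expr1n mul1r.
  (* Rows are indexed by m, columns by k. The majorant is the unsigned array, with total A (1 - y) ^
     (- c) for y = xi / (1 - u) ^ alpha; the signed array has total A (1 + y) ^ (- c), which is the
     required generating function without u ^ n. *)
  apply: (@has_sum_interchange _
    (fun m k => pdtp_cdf_term k m * u ^+ k) _ _ _ _ _ _ (fun m => @inner m u ur)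
    (has_sumZ A (has_sum_negbin c0 y1))).
  - move=> m j; rewrite /pdtp_cdf_term normrM sgn -normrM ger0_norm//.
    rewrite !mulr_ge0 ?powR_ge0 ?negbin_ge0 ?exprn_ge0 ?(ltW c0)//.
    by rewrite addr_ge0// mulr_ge0 ?addr_ge0 ?(ltW c0)// ltW.
  - move=> m; have /has_sum_ext := has_sumZ ((-1) ^+ m) (@inner m u ur).
    by apply => j; rewrite mulrA.
  have := has_sumZ A (has_sum_negbin c0 y1').
  rewrite (_ : A * _ = (xi `^ nu / (xi + (1 - u) `^ alpha) `^ nu) ^+ n / (1 - u)).
    move/has_sum_ext; apply => m; rewrite (exprNn (xi / _)) -/c -/A; ring.
  rewrite opprK.
  have -> : 1 + xi / (1 - u) `^ alpha = (xi + (1 - u) `^ alpha) / (1 - u) `^ alpha.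
    by rewrite mulrDl divff ?gt_eqF// addrC.
  have s0 : 0 < xi + (1 - u) `^ alpha by rewrite addr_gt0.
  rewrite powRM ?invr_ge0 ?(ltW s0) ?(ltW va0)//.
  rewrite -(powR_inv1 (ltW va0)) -!powRrM exprMn exprVn -!powR_mulrn ?powR_ge0//.
  rewrite -!powRrM (mulrC nu) -/c /A opprD gt0_powRD//.
  rewrite (powR_inv1 (ltW v0)).
  have -> : alpha * (-1 * - c) = alpha * c by ring.
  rewrite !powRN; field.
  by rewrite !gt_eqF// powR_gt0.
have r2 : 0 < r / 2 < r by rewrite divr_gt0//= gtr_pMr// invf_lt1// ltr1n.
have [t tE _] := interchange _ r2.
(* The column sums depend on u only through u ^ k. Dividing at the single point r / 2 gives the
   value free of u. *)
pose Rk k := t k / (r / 2) ^+ k.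
have RkE j : has_sum (pdtp_cdf_term j) (Rk j).
  have r2j : (r / 2) ^+ j != 0 by rewrite expf_neq0// gt_eqF//; case/andP: r2.
  rewrite /Rk [t j / _]mulrC.
  have /has_sum_ext := has_sumZ ((r / 2) ^+ j)^-1 (tE j); apply => m.
  by rewrite mulrC mulfK.
suff -> : convcdf p n (n + k) = Rk k by exact: RkE.
apply/eqP; rewrite -subr_eq0; apply/eqP.
(* Both power series have the same sum on (0, r); the expanded one is shifted by n places, hence the
   zeros below n. *)
have := powerseries_eq0 
  (d := fun t => convcdf p n t - if (t < n)%N then 0 else Rk (t - n)%N)
  r0 _ (n + k)%N.
rewrite ltnNge leq_addr /= addKn; apply => u ur.
have u0 : 0 <= u by case/andP: ur => /ltW.
have u1 := u_lt1 ur.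
have [t' t'E t'S] := interchange _ ur.
have u01 : 0 <= u < 1 by rewrite u0.
have h1 := convcdf_has_sum n p0 u0 u1 (pgf u01).
have h2 := has_sum_shift n (has_sumZ (u ^+ n) t'S).
have /has_sum_ext := has_sumB h1 h2.
rewrite (_ : _ - _ = 0); last by rewrite mulrAC exprMn; ring.
apply => j; rewrite mulrBl; congr (_ - _); case: ltnP => nj; first by rewrite mul0r.
rewrite (has_sum_unique (t'E (j - n)%N) (_ : has_sum _ (u ^+ (j - n) * Rk (j - n)%N))).
  by rewrite mulrA -exprD subnKC// mulrC.
have /has_sum_ext := has_sumZ (u ^+ (j - n)) (RkE (j - n)%N).
by apply => m; rewrite mulrC.
Qed.

End pdtp_cdf.

(** * Euler's Gamma function *)

Section gamma.
Context {R : realType}.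
Implicit Types (c s x : R).
Local Notation mu := (@lebesgue_measure R).
Local Notation D := (`]0%R, +oo[%classic : set R).

(** The integrand of Gamma(c + 1). With this shift c >= 0 keeps it bounded near 0. *)
Definition gamma_density c s : R := s `^ c * expR (- s).

Let ed k s : R := expR (- (k * s)).

Lemma gamma_density_ge0 c s : 0 <= gamma_density c s.
Proof. by rewrite mulr_ge0 ?powR_ge0 ?expR_ge0. Qed.

(** Half of the exponential absorbs the power. The bound serves as integrable majorant and gives the
    decay at infinity. *)
Let gd_le c s : 0 <= c -> 0 <= s -> gamma_density c s <= (2 * c) `^ c * ed 2^-1 s.
Proof.
move=> c0 s0; have -> : gamma_density c s = s `^ c * ed 2^-1 s * ed 2^-1 s.
  by rewrite /ed -mulrA -expRD -opprD (mulrC _ s) -splitr.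
rewrite ler_wpM2r ?expR_ge0// /ed.
have [->|cn0] := eqVneq c 0.
  by rewrite mulr0 !powRr0 mul1r -expR0 ler_expR oppr_le0 mulr_ge0.
have c20 : 0 < 2 * c by rewrite mulr_gt0// lt_def cn0.
(* With s = 2 c w the claim is the c-th power of w <= exp w. *)
have [w w0 ->] : exists2 w, 0 <= w & s = 2 * c * w.
  exists (s / (2 * c)); first by rewrite divr_ge0 ?(ltW c20).
  by field.
rewrite powRM ?(ltW c20)// -mulrA ler_piMr ?powR_ge0//.
rewrite (_ : - _ = - (w * c)); last by field.
rewrite expRN ler_pdivrMr ?expR_gt0// mul1r expRM.
apply: ge0_ler_powR; rewrite ?nnegrE ?expR_ge0//.
by apply: le_trans (expR_ge1Dx _); rewrite lerDr.
Qed.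

Let measurable_gd c : measurable_fun D (gamma_density c).
Proof.
apply: measurable_funTS; rewrite /gamma_density.
apply: measurable_funM; first exact: measurable_powR.
by apply: (measurableT_comp (f := expR)) => //.
Qed.

Let measurable_ed k : measurable_fun D (ed k).
Proof.
apply: measurable_funTS; apply: (measurableT_comp (f := expR)) => //.
by apply: measurable_funN; apply: measurable_funM.
Qed.

Let is_derive_ed k x : is_derive x 1 (ed k) (- k * ed k x).
Proof.
have g : is_derive x 1 (fun y : R => - (k * y)) (- k).
  rewrite (_ : (fun _ => _) = (- k) \*: (id : R -> R)).
    have := is_deriveZ (- k) (is_derive_id x (1 : R)).
    by move/is_derive_eq; apply; rewrite /GRing.scale/= mulr1.
  by apply/funext => y; rewrite /= /GRing.scale/= mulNr.
have := @is_derive1_comp _ expR (fun y => - (k * y)) x _ _ (is_derive_expR _) g.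
by rewrite [_ * - k]mulrC.
Qed.

Let ed_cvg0 k : 0 < k -> ed k s @[s --> +oo] --> 0.
Proof.
move=> k0; have h : (fun s : R => k * s) @ +oo --> +oo by exact: gt0_cvgMry.
exact: (cvg_comp _ _ h (@cvgr_expR R)).
Qed.

Let continuous_ed k : continuous (ed k).
Proof.
move=> x; apply: differentiable_continuous; apply/derivable1_diffP.
by have [] := is_derive_ed k x.
Qed.

Let integral_ed k : 0 < k -> (\int[mu]_(s in D) (ed k s)%:E = k^-1%:E)%E.
Proof.
move=> k0.
rewrite integral_itv_obnd_cbnd; last exact/measurable_EFinP.
have dF x : is_derive x 1 (fun s => - k^-1 * ed k s) (ed k x).
  have := is_deriveZ (- k^-1) (is_derive_ed k x).
  move/is_derive_eq; apply; rewrite /GRing.scale/= mulrA mulrNN mulVf ?mul1r//.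
  by rewrite gt_eqF.
rewrite (@ge0_continuous_FTC2y _ (ed k) (fun s => - k^-1 * ed k s) 0 0).
- by rewrite /ed mulr0 oppr0 expR0 mulr1 -EFinB sub0r opprK.
- by move=> x _; exact: expR_ge0.
- by apply: continuous_subspaceT; exact: continuous_ed.
- rewrite -[X in _ --> X](mulr0 (- k^-1)); apply: cvgM; first exact: cvg_cst.
  exact: ed_cvg0.
- by move=> x _; have [] := dF x.
- apply: cvg_at_right_filter; apply: cvgM; first exact: cvg_cst.
  exact: continuous_ed.
- by move=> x _; rewrite derive1E; have [_] := dF x.
Qed.

Let integrable_ed k : 0 < k -> mu.-integrable D (EFin \o ed k).
Proof.
move=> k0; apply/integrableP; split.
  by apply/measurable_EFinP; exact: measurable_ed.
under eq_integral do rewrite /= ger0_norm ?expR_ge0//.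
by rewrite integral_ed// ltry.
Qed.

Let integrable_edZ a k : 0 < k -> mu.-integrable D (EFin \o (fun s => a * ed k s)).
Proof.
move=> k0; have : mu.-integrable D (fun s => a%:E * (EFin \o ed k) s)%E.
  by apply: integrableZl => //; exact: integrable_ed.
by [].
Qed.

Lemma integrable_gamma_density c :
  0 <= c -> mu.-integrable D (EFin \o gamma_density c).
Proof.
move=> c0.
have h2 : 0 < 2^-1 :> R by [].
apply: le_integrable (integrable_edZ ((2 * c) `^ c) h2) => //.
  by apply/measurable_EFinP; exact: measurable_gd.
move=> s; rewrite /= in_itv/= andbT => /ltW s0; rewrite lee_fin.
rewrite !ger0_norm ?gamma_density_ge0 ?mulr_ge0 ?powR_ge0 ?expR_ge0//.
exact: gd_le.
Qed.

Lemma GammaE c : Gamma (c + 1) = \int[mu]_(s in D) gamma_density c s.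
Proof. by rewrite /Gamma addrK. Qed.

Lemma Gamma1 : Gamma 1 = 1 :> R.
Proof.
have := GammaE 0; rewrite add0r => ->; rewrite /Rintegral.
transitivity (fine (\int[mu]_(s in D) (ed 1 s)%:E)%E).
  congr fine; apply: eq_integral => s _.
  by rewrite /gamma_density powRr0 mul1r /ed mul1r.
by rewrite integral_ed// invr1.
Qed.

Let powR_cvg_at0 c : 0 <= c -> s `^ c @[s --> 0^'+] --> (0 : R) `^ c.
Proof.
rewrite le_eqVlt => /predU1P[<-|c0].
  by under eq_fun do rewrite powRr0; rewrite powRr0; exact: cvg_cst.
by rewrite powR0 ?gt_eqF//; exact: powR_cvg0.
Qed.

Let is_derive_expN x : is_derive x 1 (fun s : R => expR (- s)) (- expR (- x)).
Proof.
have := is_derive_ed 1 x; rewrite /ed mul1r mulN1r.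
by under eq_fun do rewrite mul1r.
Qed.

Let continuous_expN : continuous (fun s : R => expR (- s)).
Proof.
move=> x; apply: differentiable_continuous; apply/derivable1_diffP.
by have [] := is_derive_expN x.
Qed.

Let gd_cvg_at0 c : 0 <= c -> gamma_density c s @[s --> 0^'+] --> gamma_density c 0.
Proof.
move=> c0; apply: cvgM; first exact: powR_cvg_at0.
apply: cvg_at_right_filter; exact: continuous_expN.
Qed.

Let is_derive_gd c x : 0 < x ->
  is_derive x 1 (gamma_density (c + 1))
    ((c + 1) * gamma_density c x - gamma_density (c + 1) x).
Proof.
move=> x0; have := is_deriveM (@is_derive1_powR R (c + 1) x x0) (is_derive_expN x).
move/is_derive_eq; apply; rewrite /GRing.scale/= addrK /gamma_density; ring.
Qed.

Let continuous_gd c x : 0 < x -> {for x, continuous (gamma_density c)}.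
Proof.
move=> x0; apply: differentiable_continuous; apply/derivable1_diffP.
by rewrite -(subrK 1 c); have [] := is_derive_gd (c - 1) x0.
Qed.

Let gd_cvgy c : 0 <= c -> gamma_density c s @[s --> +oo] --> 0.
Proof.
move=> c0.
apply: (@squeeze_cvgr _ _ _ _ (cst 0) (fun s => (2 * c) `^ c * ed 2^-1 s)).
- apply: filterS (nbhs_pinfty_ge (real0 R)) => s s0.
  by rewrite gamma_density_ge0 gd_le.
- exact: cvg_cst.
- rewrite -[X in _ --> X](mulr0 ((2 * c) `^ c)); apply: cvgM; first exact: cvg_cst.
  exact: ed_cvg0.
Qed.

(* Adding the multiple of exp (- s / 2) makes the derivative of s ^ (c + 1) exp (- s)
   nonnegative, as the fundamental theorem of calculus on a half-line requires. *)
Lemma GammaD1 c : 0 <= c -> Gamma (c + 1 + 1) = (c + 1) * Gamma (c + 1).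
Proof.
move=> c0; have c10 : 0 <= c + 1 by rewrite addr_ge0.
have h2 : 0 < 2^-1 :> R by [].
set K := (2 * (c + 1)) `^ (c + 1).
pose f s := (c + 1) * gamma_density c s - gamma_density (c + 1) s + K * ed 2^-1 s.
pose F s := gamma_density (c + 1) s + (- (2 * K)) * ed 2^-1 s.
have dF x : 0 < x -> is_derive x 1 F (f x).
  move=> x0; have := is_deriveD (is_derive_gd c x0)
    (is_deriveZ (- (2 * K)) (is_derive_ed 2^-1 x)).
  by move/is_derive_eq; apply; rewrite /f /GRing.scale/=; field.
have intf : (\int[mu]_(s in D) (f s)%:E = (2 * K)%:E)%E.
  rewrite integral_itv_obnd_cbnd; last first.
    apply/measurable_EFinP; apply: measurable_funD; last exact: measurable_funM.
    by apply: measurable_funB => //; exact: measurable_funM.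
  rewrite (@ge0_continuous_FTC2y _ f F 0 0).
  - rewrite -EFinB /F /gamma_density powR0 ?gt_eqF ?ltr_wpDl//.
    by rewrite mul0r add0r /ed mulr0 oppr0 expR0 mulr1 sub0r opprK.
  - move=> x x0; rewrite /f -addrA addr_ge0//.
      by rewrite mulr_ge0// gamma_density_ge0.
    by rewrite addrC subr_ge0 gd_le.
  - apply/continuous_within_itvcyP; split.
      move=> x; rewrite in_itv/= andbT => x0.
      apply: cvgD; last by apply: cvgM; [exact: cvg_cst|exact: continuous_ed].
      by apply: cvgB; [apply: cvgM; [exact: cvg_cst|]|]; exact: continuous_gd.
    apply: cvgD.
      by apply: cvgB; [apply: cvgM; [exact: cvg_cst|]|]; exact: gd_cvg_at0.
    apply: cvgM; [exact: cvg_cst|].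
    by apply: cvg_at_right_filter; exact: continuous_ed.
  - rewrite -[X in _ --> X](addr0 0) -[X in _ --> _ + X](mulr0 (- (2 * K))).
    apply: cvgD; first exact: gd_cvgy.
    by apply: cvgM; [exact: cvg_cst|exact: ed_cvg0].
  - by move=> x x0; have [] := dF _ x0.
  - apply: cvgD; first exact: gd_cvg_at0.
    apply: cvgM; [exact: cvg_cst|].
    by apply: cvg_at_right_filter; exact: continuous_ed.
  - by move=> x; rewrite in_itv/= andbT => x0; rewrite derive1E; have [_] := dF x x0.
have ig1 := integrable_gamma_density c0.
have ig2 := integrable_gamma_density c10.
have igZ : mu.-integrable D (EFin \o (fun s => (c + 1) * gamma_density c s)).
  have : mu.-integrable D (fun s => (c + 1)%:E * (EFin \o gamma_density c) s)%E.
    exact: integrableZl.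
  by [].
have := congr1 fine intf; rewrite -[LHS]/(\int[mu]_(s in D) f s) /=.
rewrite RintegralD//; last 2 first.
- have : mu.-integrable D ((EFin \o (fun s => ((c + 1) * gamma_density c s)%R)) \-
      (EFin \o gamma_density (c + 1)))%E by exact: integrableB.
  by [].
- exact: integrable_edZ.
rewrite RintegralB// !RintegralZl//; last exact: integrable_ed.
rewrite -!GammaE.
rewrite [X in K * X](_ : _ = 2); last by rewrite /Rintegral integral_ed// invrK.
move=> h; lra.
Qed.

End gamma.

(** Combines y ^ c >= 1 + c ln y with ln y >= 1 - 1 / y, with equality at y = 1. Having 1 / y in
    place of ln y makes every term a Gamma integral once y = s / x is put against s ^ x exp (-
    s). *)
Lemma powR_ge_tangent {R : realType} (c y : R) : 0 <= c -> 0 < y ->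
  1 + c <= y `^ c + c * y^-1.
Proof.
move=> c0 y0.
have h1 : 1 + c * ln y <= y `^ c by rewrite /powR gt_eqF// expR_ge1Dx.
have h2 : 1 - ln y <= y^-1.
  by have := expR_ge1Dx (- ln y); rewrite expRN lnK// posrE.
have := ler_wpM2l c0 h2; rewrite mulrBr; lra.
Qed.

Section gamma_asymptotics.
Context {R : realType}.
Implicit Types (c x : R).
Local Notation mu := (@lebesgue_measure R).
Local Notation D := (`]0%R, +oo[%classic : set R).

Let integrable_gdZ a c : 0 <= c ->
  mu.-integrable D (EFin \o (fun s => a * gamma_density c s)).
Proof.
move=> c0.
have : mu.-integrable D (fun s => a%:E * (EFin \o gamma_density c) s)%E.
  by apply: integrableZl => //; exact: integrable_gamma_density.
by [].
Qed.

(** Integrate [powR_ge_tangent] at y = s / x against x ^ c s ^ x exp (- s). The 1 / y term yields c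
    x ^ c x Gamma(x) = c x ^ c Gamma(x + 1), which cancels the surplus c on the left. *)
Lemma Gamma_ge c x : 0 <= c -> 1 <= x ->
  x `^ c * Gamma (x + 1) <= Gamma (x + c + 1).
Proof.
move=> c0 x1; have x0 : 0 < x by exact: lt_le_trans x1.
have x10 : 0 <= x - 1 by rewrite subr_ge0.
have xc0 : 0 <= x + c by rewrite addr_ge0// ltW.
have Gx : Gamma (x + 1) = x * Gamma x.
  by have := GammaD1 x10; rewrite subrK.
have : \int[mu]_(s in D) (((1 + c) * x `^ c) * gamma_density x s) <=
    \int[mu]_(s in D) (gamma_density (x + c) s +
      (c * x * x `^ c) * gamma_density (x - 1) s).
  apply: le_Rintegral => //.
  - by apply: integrable_gdZ; exact: ltW.
  - have : mu.-integrable D ((EFin \o gamma_density (x + c)) \+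
      (EFin \o (fun s => ((c * x * x `^ c) * gamma_density (x - 1) s)%R)))%E.
      apply: integrableD => //; first exact: integrable_gamma_density.
      exact: integrable_gdZ.
    by [].
  - move=> s; rewrite /= in_itv/= andbT => s0.
    have y0 : 0 < s / x by rewrite divr_gt0.
    have := powR_ge_tangent c0 y0.
    have p0 : 0 <= x `^ c * s `^ x * expR (- s).
      by rewrite !mulr_ge0 ?powR_ge0 ?expR_ge0.
    move=> /(ler_wpM2l p0).
    have sc : s `^ c = x `^ c * (s / x) `^ c.
      by rewrite -powRM ?(ltW x0) ?(ltW y0)// mulrC divfK// gt_eqF.
    rewrite /gamma_density !gt0_powRD// powRN powRr1 ?(ltW s0)// sc invf_div.
    set A := x `^ c; set B := s `^ x; set C := (s / x) `^ c; set E := expR _.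
    rewrite (_ : A * B * E * (1 + c) = (1 + c) * A * (B * E)); last by ring.
    rewrite (_ : A * B * E * (C + c * (x / s)) =
      B * (A * C) * E + c * x * A * (B / s * E))//; ring.
have ix : mu.-integrable D (EFin \o gamma_density x).
  by apply: integrable_gamma_density; exact: ltW.
rewrite RintegralZl// RintegralD//; last 2 first.
- exact: integrable_gamma_density.
- exact: integrable_gdZ.
rewrite RintegralZl//; last exact: integrable_gamma_density.
rewrite -!GammaE subrK.
rewrite (_ : c * x * x `^ c * Gamma x = c * x `^ c * Gamma (x + 1)); last first.
  by rewrite Gx; ring.
move=> h; lra.
Qed.


Lemma Gamma_nat n : Gamma (n%:R + 1) = n`!%:R :> R.
Proof.
elim: n => [|n IH]; first by rewrite add0r Gamma1.
by rewrite -natr1 GammaD1// IH factS natrM natr1.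
Qed.

Lemma Gamma_gt0 c : 0 <= c -> 0 < Gamma (c + 1).
Proof.
move=> c0; have := Gamma_ge c0 (lexx 1).
have -> : Gamma (1 + 1) = 1 :> R.
  by have := @GammaD1 R 0 (lexx 0); rewrite add0r mul1r Gamma1.
rewrite powR1 mul1r (addrC 1) GammaD1//.
by move=> /(lt_le_trans ltr01); rewrite pmulr_rgt0// ltr_wpDl.
Qed.

Lemma Gamma_pochhammer c n : 0 <= c ->
  Gamma (n%:R + c + 1) = pochhammer (c + 1) n * Gamma (c + 1).
Proof.
move=> c0; elim: n => [|n IH]; first by rewrite pochhammer0 mul1r add0r.
have nc0 : 0 <= n%:R + c by rewrite addr_ge0.
rewrite pochhammerS mulrAC -IH (_ : c + 1 + n%:R = n%:R + c + 1); last by ring.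
rewrite mulrC -(GammaD1 nc0) -natr1.
by congr Gamma; ring.
Qed.

Lemma negbin_Gamma c n : 0 <= c ->
  negbin (c + 1) n * Gamma (c + 1) = Gamma (n%:R + c + 1) / n`!%:R.
Proof. by move=> c0; rewrite Gamma_pochhammer// negbinE mulrAC. Qed.

Let fact_le n k : (n + k)`!%:R <= n`!%:R * (n + k)%:R ^+ k :> R.
Proof.
rewrite -natrX -natrM ler_nat; elim: k => [|k IH].
  by rewrite addn0 expn0 muln1.
rewrite addnS factS expnS mulnCA leq_mul//.
apply: (leq_trans IH); rewrite leq_mul//.
by case: k {IH} => // k; rewrite leq_exp2r.
Qed.

(** Both sides come from [Gamma_ge]: the lower one from n up to n + c, the upper one from n + c up
    to n + k, where Gamma is a factorial and (n + k)! <= n! (n + k) ^ k. *)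
Let negbin_asymp c n k : 0 <= c -> c <= k%:R -> (0 < n)%N ->
  1 <= negbin (c + 1) n * Gamma (c + 1) * n%:R `^ (- c) <=
    ((n + k)%:R / n%:R) ^+ k.
Proof.
move=> c0 ck n0; have n1 : 1 <= n%:R :> R by rewrite ler1n.
have nr0 : 0 < n%:R :> R by rewrite ltr0n.
have f0 : 0 < n`!%:R :> R by rewrite ltr0n fact_gt0.
rewrite negbin_Gamma// powRN; apply/andP; split.
  rewrite ler_pdivlMr ?powR_gt0// mul1r ler_pdivlMr// -Gamma_nat.
  exact: Gamma_ge.
rewrite ler_pdivrMr ?powR_gt0// ler_pdivrMr//.
have kc0 : 0 <= k%:R - c by rewrite subr_ge0.
have nc1 : 1 <= n%:R + c by rewrite (le_trans n1)// lerDl.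
have := Gamma_ge kc0 nc1.
have -> : n%:R + c + (k%:R - c) + 1 = (n + k)%:R + 1 by rewrite natrD; ring.
rewrite Gamma_nat => h.
have p0 : 0 < n%:R `^ (k%:R - c) :> R by rewrite powR_gt0.
rewrite -(ler_pM2l p0); apply: le_trans (_ : _ <= (n + k)`!%:R) _.
  have G0 : 0 <= Gamma (n%:R + c + 1) by rewrite ltW// Gamma_gt0// addr_ge0.
  apply: le_trans h; rewrite ler_wpM2r//.
  by apply: ge0_ler_powR; rewrite ?nnegrE ?lerDl// addr_ge0.
apply: le_trans (fact_le _ _) _.
rewrite (_ : n%:R `^ (k%:R - c) * _ = n`!%:R *
  (((n + k)%:R / n%:R) ^+ k * (n%:R `^ (k%:R - c) * n%:R `^ c))); last by ring.
rewrite -gt0_powRD// subrK powR_mulrn// exprMn exprVn divfK//.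
by rewrite expf_neq0// gt_eqF.
Qed.

Let ratio_cvg1 k : ((n + k)%:R / n%:R) @[n --> \oo] --> (1 : R).
Proof.
rewrite -cvg_shiftS /=.
have : (fun n => 1 + k%:R * harmonic n) @ \oo --> (1 + k%:R * 0 : R).
  apply: cvgD; first exact: cvg_cst.
  by apply: cvgM; [exact: cvg_cst|exact: cvg_harmonic].
rewrite mulr0 addr0; apply: cvg_trans; apply: near_eq_cvg; near=> n.
by rewrite natrD mulrDl divff// pnatr_eq0.
Unshelve. all: by end_near. Qed.

Let ratioX_cvg1 j k : ((n + j)%:R / n%:R) ^+ k @[n --> \oo] --> (1 : R).
Proof.
elim: k => [|k IH]; first exact: cvg_cst.
have : (fun n => (n + j)%:R / n%:R * ((n + j)%:R / n%:R) ^+ k) @ \oo --> (1 * 1 : R).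
  by apply: cvgM => //; exact: ratio_cvg1.
by rewrite mulr1; under [in X in _ -> X]eq_fun do rewrite exprS.
Qed.

Let negbin_cvg c : 0 <= c ->
  negbin (c + 1) n * n%:R `^ (- c) @[n --> \oo] --> (Gamma (c + 1))^-1.
Proof.
move=> c0; have G0 := Gamma_gt0 c0.
have [k ck] : exists k : nat, c <= k%:R.
  by exists (Num.truncn c).+1; rewrite ltW// truncnS_gt.
have h : negbin (c + 1) n * Gamma (c + 1) * n%:R `^ (- c) @[n --> \oo] --> (1 : R).
  apply: (@squeeze_cvgr _ _ _ _ (cst 1) (fun n => ((n + k)%:R / n%:R) ^+ k)).
  - by near=> n; apply: negbin_asymp => //; near: n; exact: nbhs_infty_gt.
  - exact: cvg_cst.
  - exact: ratioX_cvg1.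
have : (fun n => (Gamma (c + 1))^-1 *
    (negbin (c + 1) n * Gamma (c + 1) * n%:R `^ (- c)))
   @ \oo --> (Gamma (c + 1))^-1 * 1.
  by apply: cvgM => //; exact: cvg_cst.
rewrite mulr1; apply: cvg_trans; apply: near_eq_cvg; near=> n.
by rewrite mulrAC mulrC mulfK// gt_eqF.
Unshelve. all: by end_near. Qed.

Lemma negbin_sub_cvg c j : 0 <= c ->
  negbin (c + 1) (n - j) * n%:R `^ (- c) @[n --> \oo] --> (Gamma (c + 1))^-1.
Proof.
(* Replacing n by n + j removes the truncated subtraction; the normalisation then changes by ((n +
   j) / n) ^ (- c), which tends to 1. *)
move=> c0; rewrite -(cvg_shiftn j) /=.
have [k ck] : exists k : nat, c <= k%:R.
  by exists (Num.truncn c).+1; rewrite ltW// truncnS_gt.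
have h : ((n + j)%:R / n%:R) `^ (- c) @[n --> \oo] --> (1 : R).
  apply: (@squeeze_cvgr _ _ _ _ (fun n => ((n + j)%:R / n%:R) ^- k) (cst 1)).
  - near=> n; have n0 : 0 < n%:R :> R by rewrite ltr0n; near: n; exact: nbhs_infty_gt.
    have b1 : 1 <= (n + j)%:R / n%:R :> R.
      by rewrite ler_pdivlMr// mul1r ler_nat leq_addr.
    have b0 := lt_le_trans ltr01 b1.
    rewrite -powR_invn ?(ltW b0)// ler_powR ?lerN2//=.
    have c0' : - c <= 0 by rewrite oppr_le0.
    by have := ler_powR b1 c0'; rewrite powRr0.
  - by rewrite -[X in _ --> X]invr1; apply: cvgV; [exact: oner_neq0|exact: ratioX_cvg1].
  - exact: cvg_cst.
have : (fun n => negbin (c + 1) n * n%:R `^ (- c) * ((n + j)%:R / n%:R) `^ (- c))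
   @ \oo --> (Gamma (c + 1))^-1 * 1.
  by apply: cvgM => //; exact: negbin_cvg.
rewrite mulr1; apply: cvg_trans; apply: near_eq_cvg; near=> n.
have n0 : 0 < n%:R :> R by rewrite ltr0n; near: n; exact: nbhs_infty_gt.
rewrite addnK -mulrA -powRM ?divr_ge0//.
by rewrite [n%:R * _]mulrC divfK// gt_eqF.
Unshelve. all: by end_near. Qed.

End gamma_asymptotics.

(** * The discrete-time process *)

Lemma normc_real {R : realType} (x : R) :
  0 <= x -> ComplexField.Normc.normc x%:C%C = x.
Proof. by move=> x0; rewrite /= expr0n addr0 sqrtr_sqr ger0_norm. Qed.

Lemma principal_pow_real {R : realType} (x a : R) :
  0 < x -> principal_pow x%:C%C a = (x `^ a)%:C%C.
Proof.
move=> x0; rewrite /principal_pow /principal_arg normc_real ?(ltW x0)//= lexx.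
by rewrite divff ?gt_eqF// acos1 mulr0 cos0 sin0 -[(_ +i* _)%C]/(1%:C)%C rmorph1 mulr1.
Qed.

Section pdtp.
Context {d : measure_display} {T : measurableType d} {R : realType}.
Variables (P : probability T R) (Z : nat -> {RV P >-> nat}).
Variables (alpha nu xi : R).
Hypotheses (alpha0 : 0 < alpha) (nu0 : 0 < nu) (xi0 : 0 < xi).
Hypothesis PDTP : is_PDTP Z alpha nu xi.

Lemma PDTP_pmf_has_sum (u : R) : 0 <= u < 1 ->
  has_sum (fun k => interarrival_pmf Z k * u ^+ k)
    (xi `^ nu * u / (xi + (1 - u) `^ alpha) `^ nu).
Proof.
move=> /andP[u0 u1]; have v0 : 0 < 1 - u by rewrite subr_gt0.
have := PDTP_pgf PDTP 0%N (u := u%:C%C); rewrite normc_real// => /(_ (ltW u1)).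
rewrite -(rmorph1 (real_complex R)) -rmorphB principal_pow_real//.
rewrite -rmorphD principal_pow_real; last by rewrite addr_gt0// powR_gt0.
rewrite -rmorphM -fmorph_div.
exact: (interarrival_pgf (PDTP_identical PDTP) u0 (ltW u1)).
Qed.

Lemma PDTP_mean_has_sum t : xi < 1 ->
  has_sum (fun m => \sum_(1 <= n < t.+1) pdtp_cdf_term alpha nu xi n (t - n) m)
    (\sum_(1 <= n < t.+1) convcdf (interarrival_pmf Z) n t).
Proof.
move=> xi1; rewrite big_nat.
have h i : (1 <= i < t.+1)%N -> has_sum (pdtp_cdf_term alpha nu xi i (t - i))
    (convcdf (interarrival_pmf Z) i t).
  move=> /andP[i0 it]; rewrite ltnS in it.
  have := convcdf_pdtp alpha0 nu0 xi0 xi1 i0 (@interarrival_pmf_ge0 _ _ _ _ Z)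
    PDTP_pmf_has_sum (k := (t - i)%N).
  by rewrite subnKC.
have /has_sum_ext := has_sum_sum (r := index_iota 1 t.+1) h; apply => m.
by rewrite [RHS]big_nat.
Qed.

End pdtp.

(** * The scaling limit *)

(** For 0 <= y <= 1/2 one has 1 / (1 - y) <= 1 + 2 y <= exp (2 y); take y = K / N and the N-th
    power. *)
Lemma onem_expN_le {R : realType} (K : R) (N : nat) :
  0 <= K -> (0 < N)%N -> 2 * K <= N%:R ->
  (1 - K / N%:R) ^- N <= expR (2 * K).
Proof.
move=> K0 N0 KN; have Nr0 : 0 < N%:R :> R by rewrite ltr0n.
set y := K / N%:R.
have y0 : 0 <= y by rewrite divr_ge0.
have y2 : 2 * y <= 1 by rewrite mulrA ler_pdivrMr// mul1r.
have u0 : 0 < 1 - y by lra.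
have -> : expR (2 * K) = expR (2 * y) ^+ N.
  by rewrite -expRM_natl; congr expR; rewrite /y; field; rewrite gt_eqF.
rewrite -exprVn lerXn2r ?nnegrE ?expR_ge0 ?invr_ge0 ?(ltW u0)//.
apply: le_trans (expR_ge1Dx _); rewrite -[_^-1]mul1r ler_pdivrMr//.
rewrite (_ : (1 + 2 * y) * (1 - y) = 1 + y * (1 - 2 * y)); last by ring.
by rewrite lerDl mulr_ge0// subr_ge0.
Qed.

Section scaling_limit.
Context {R : realType}.
Variables (alpha nu x : R) (p : R -> nat -> R).
Hypotheses (alpha0 : 0 < alpha) (nu0 : 0 < nu) (x0 : 0 < x).
Hypothesis p0 : forall (xi : R) k, 0 < xi -> 0 <= p xi k.
Hypothesis pgf : forall xi u : R, 0 < xi -> 0 <= u < 1 ->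
  has_sum (fun k => p xi k * u ^+ k)
    (xi `^ nu * u / (xi + (1 - u) `^ alpha) `^ nu).

Let xiN (N : nat) : R := x * N%:R `^ (- alpha).

(* All bounds come from evaluating generating functions at 1 - K / N, where
   (K / N) ^ alpha is twice the parameter xiN N. *)
Let K : R := (2 * x) `^ alpha^-1.

Let uN (N : nat) : R := 1 - K / N%:R.

Let K0 : 0 < K. Proof. by rewrite powR_gt0// mulr_gt0. Qed.

Let uN_near : \forall N \near \oo, [/\ 0 < uN N < 1,
  uN N ^- N <= expR (2 * K), (1 - uN N) `^ alpha = 2 * xiN N, 0 < xiN N & xiN N < 1].
Proof.
near=> N.
have N0 : (0 < N)%N by near: N; exact: nbhs_infty_gt.
have Nr0 : 0 < N%:R :> R by rewrite ltr0n.
have KN : 2 * K < N%:R by near: N; exact: nbhs_infty_gtr.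
have KN2 : K / N%:R < 2^-1 by rewrite ltr_pdivrMr//; lra.
have uE : (1 - uN N) `^ alpha = 2 * xiN N.
  rewrite /uN opprB addrC subrK powRM ?invr_ge0 ?(ltW K0) ?(ltW Nr0)//.
  rewrite /K -powRrM mulVf ?gt_eqF// powRr1 ?mulr_ge0 ?(ltW x0)//.
  rewrite /xiN mulrA; congr (_ * _).
  by rewrite -(powR_inv1 (ltW Nr0)) -powRrM mulN1r.
have x0N : 0 < xiN N by rewrite mulr_gt0// powR_gt0.
split=> //.
- rewrite /uN subr_gt0 gtrDl oppr_lt0 divr_gt0// andbT.
  by rewrite (lt_trans KN2)// invf_lt1// ltr1n.
- by apply: onem_expN_le => //; exact: ltW.
- have v0 : 0 <= 1 - uN N by rewrite /uN opprB addrC subrK divr_ge0// ltW.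
  have v1 : 1 - uN N <= 1 by rewrite /uN opprB addrC subrK; lra.
  have : (1 - uN N) `^ alpha <= 1.
    by have := ge0_ler_powR (ltW alpha0) _ _ v1; rewrite powR1; apply; rewrite nnegrE.
  by rewrite uE; lra.
Unshelve. all: by end_near. Qed.

Let convcdf_le : \forall N \near \oo, forall n,
  `|convcdf (p (xiN N)) n N| <= expR (2 * K) * ((3^-1) `^ nu) ^+ n.
Proof.
apply: filterS uN_near => N [/andP[u0 u1] uK uE xi0 xi1] n.
have pN0 k := p0 k xi0.
have Q0 : 0 <= convcdf (p (xiN N)) n N by apply: sumr_ge0 => i _; exact: convpow_ge0.
rewrite ger0_norm//.
have u01 : 0 <= uN N < 1 by rewrite (ltW u0).
set g := xiN N `^ nu * uN N / (xiN N + (1 - uN N) `^ alpha) `^ nu.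
have qs := convpow_has_sum n pN0 (ltW u0) (pgf xi0 u01).
have g0 : 0 <= g by rewrite !mulr_ge0 ?invr_ge0 ?powR_ge0 ?(ltW u0).
(* The choice of [uN] makes the denominator (3 xi) ^ nu, so the powers of xi cancel and the ratio no
   longer depends on N. *)
have gle : g <= (3^-1) `^ nu.
  rewrite /g uE (_ : xiN N + 2 * xiN N = 3 * xiN N); last by ring.
  rewrite powRM ?(ltW xi0)//.
  have -> : xiN N `^ nu * uN N / (3 `^ nu * xiN N `^ nu) = uN N * (3 `^ nu)^-1.
    by field; rewrite !gt_eqF// powR_gt0.
  rewrite -[X in _ <= X `^ _]powR_inv1// -powRrM mulN1r powRN.
  by rewrite ler_piMl ?invr_ge0 ?powR_ge0// ltW.
have q0 k : 0 <= convpow (p (xiN N)) n k * uN N ^+ k.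
  by rewrite mulr_ge0 ?exprn_ge0 ?(ltW u0)// convpow_ge0.
have h1 : convcdf (p (xiN N)) n N * uN N ^+ N <= g ^+ n.
  apply: le_trans (has_sum_le N.+1 q0 qs).
  rewrite /convcdf /series/= big_mkord mulr_suml; apply: ler_sum => i _.
  rewrite ler_wpM2l ?convpow_ge0//.
  by rewrite ler_wiXn2l ?(ltW u0) ?(ltW u1)// -ltnS.
have uNn0 : 0 < uN N ^+ N by rewrite exprn_gt0.
move: h1; rewrite -ler_pdivlMr// => /le_trans; apply.
rewrite mulrC ler_pM ?invr_ge0 ?exprn_ge0 ?(ltW uNn0) ?(ltW u0)//.
by rewrite lerXn2r ?nnegrE ?powR_ge0.
Qed.

Let lim_term n m : R := (-1) ^+ m * (x `^ (nu * n%:R + m%:R) *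
  negbin (n%:R * nu) m / Gamma (alpha * (m%:R + n%:R * nu) + 1)).

(** The power of [xiN N] contributes N ^ (- alpha (m + n nu)), which is exactly the normalisation in
    [negbin_sub_cvg]. *)
Let term_cvg n m : (0 < n)%N ->
  pdtp_cdf_term alpha nu (xiN N) n (N - n) m @[N --> \oo] --> lim_term n m.
Proof.
move=> n0; have c0 : 0 <= alpha * (m%:R + n%:R * nu).
  by rewrite mulr_ge0 ?addr_ge0 ?mulr_ge0 ?(ltW alpha0) ?(ltW nu0).
set A := (-1) ^+ m * (x `^ (nu * n%:R + m%:R) * negbin (n%:R * nu) m).
have -> : lim_term n m = A * (Gamma (alpha * (m%:R + n%:R * nu) + 1))^-1.
  by rewrite /lim_term /A !mulrA.
have : (fun N => A * (negbin (alpha * (m%:R + n%:R * nu) + 1) (N - n) *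
    N%:R `^ (- (alpha * (m%:R + n%:R * nu))))) @ \oo -->
    A * (Gamma (alpha * (m%:R + n%:R * nu) + 1))^-1.
  by apply: cvgM; [exact: cvg_cst|exact: negbin_sub_cvg].
apply: cvg_trans; apply: near_eq_cvg; near=> N.
have N0 : 0 < N%:R :> R by rewrite ltr0n; near: N; exact: nbhs_infty_gt.
rewrite /pdtp_cdf_term /A /xiN powRM ?(ltW x0) ?powR_ge0// -powRrM.
rewrite (_ : - alpha * (nu * n%:R + m%:R) =
  - (alpha * (m%:R + n%:R * nu))); last by ring.
ring.
Unshelve. all: by end_near. Qed.

(** At [uN N] the factor (1 - u) ^ (- alpha (m + n nu)) equals (2 xi) ^ (- E) with E = nu n + m. It
    cancels xi ^ E and leaves 2 ^ (- E), free of N. *)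
Let term_le n : (0 < n)%N -> \forall N \near \oo, forall m,
  `|pdtp_cdf_term alpha nu (xiN N) n (N - n) m| <=
  expR (2 * K) * (2^-1) `^ (nu * n%:R) * (negbin (n%:R * nu) m * 2^-1 ^+ m).
Proof.
move=> n0; apply: filterS uN_near => N [/andP[u0 u1] uK uE xi0 xi1] m.
have n'0 : 0 < n%:R :> R by rewrite ltr0n.
have c0 : 0 < n%:R * nu by rewrite mulr_gt0.
have e0 : 0 < m%:R + n%:R * nu by rewrite ltr_wpDl.
have ae0 : 0 < alpha * (m%:R + n%:R * nu) by rewrite mulr_gt0.
rewrite /pdtp_cdf_term normrM normrX normrN1 expr1n mul1r ger0_norm; last first.
  by rewrite !mulr_ge0 ?powR_ge0 ?negbin_ge0 ?addr_ge0 ?(ltW c0) ?(ltW ae0).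
have u01 : 0 < uN N < 1 by rewrite u0.
have h := negbin1_le (N - n) ae0 u01.
set E := nu * n%:R + m%:R.
have hE : (1 - uN N) `^ (- (alpha * (m%:R + n%:R * nu))) = (2 * xiN N) `^ (- E).
  by rewrite -uE -powRrM /E; congr powR; ring.
have hu : uN N ^- (N - n) <= expR (2 * K).
  apply: le_trans uK; rewrite lef_pV2 ?posrE ?exprn_gt0//.
  by rewrite ler_wiXn2l ?(ltW u0) ?(ltW u1)// leq_subr.
have h2 : negbin (alpha * (m%:R + n%:R * nu) + 1) (N - n) <=
    expR (2 * K) * (2 * xiN N) `^ (- E).
  by apply: le_trans h _; rewrite hE ler_wpM2r ?powR_ge0.
have pos : 0 <= xiN N `^ E * negbin (n%:R * nu) m.
  by rewrite mulr_ge0 ?powR_ge0// negbin_ge0// ltW.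
apply: le_trans (ler_wpM2l pos h2) _.
rewrite (powRM (- E) _ (ltW xi0))// !powRN.
have -> : (2^-1 : R) ^+ m = 2^-1 `^ m%:R by rewrite powR_mulrn.
rewrite -(mulrA (expR _)) [_ * (negbin _ _ * _)]mulrCA -gt0_powRD// -/E.
have -> (r : R) : 2^-1 `^ r = (2 `^ r)^-1 by rewrite -powR_inv1// -powRrM mulN1r powRN.
rewrite le_eqVlt; apply/orP; left; apply/eqP; field.
by rewrite !gt_eqF// powR_gt0.
Qed.

(** Dominated convergence in m for fixed n; the majorant converges as a binomial series at 1/2. The
    limit is identified in [prabhakar_lim]. *)
Let convcdf_cvg n : (0 < n)%N -> exists2 L, has_sum (lim_term n) L &
  convcdf (p (xiN N)) n N @[N --> \oo] --> L.
Proof.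
move=> n0; have c0 : 0 < n%:R * nu by rewrite mulr_gt0// ltr0n.
have h2 : `|2^-1| < 1 :> R by rewrite ger0_norm// invf_lt1// ltr1n.
apply: (has_sum_tannery (F := fun N => pdtp_cdf_term alpha nu (xiN N) n (N - n))
  (has_sumZ (expR (2 * K) * (2^-1) `^ (nu * n%:R)) (has_sum_negbin c0 h2))
  (term_le n0) (fun m => @term_cvg n m n0)).
near=> N.
have nN : (n <= N)%N by near: N; exact: nbhs_infty_ge.
have [u01 uK uE xi0 xi1] : [/\ 0 < uN N < 1,
  uN N ^- N <= expR (2 * K), (1 - uN N) `^ alpha = 2 * xiN N, 0 < xiN N & xiN N < 1].
  by near: N; exact: uN_near.
have := convcdf_pdtp alpha0 nu0 xi0 xi1 n0 (fun k => p0 k xi0)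
  (fun u => @pgf _ u xi0) (k := (N - n)%N).
by rewrite subnKC.
Unshelve. all: by end_near. Qed.

(** Termwise, the Prabhakar series is [lim_term n] divided by the constant x ^ (nu n); its
    convergence is thus inherited from the limit just taken. *)
Let prabhakar_lim n L : (0 < n)%N -> has_sum (lim_term n) L ->
  x `^ (nu * n%:R) * prabhakar alpha (alpha * nu * n%:R + 1) (nu * n%:R) (- x) = L.
Proof.
move=> n0 lL; have X0 : x `^ (nu * n%:R) != 0 by rewrite gt_eqF// powR_gt0.
rewrite /prabhakar (_ : limn _ = (x `^ (nu * n%:R))^-1 * L) ?mulVKf//.
apply: has_sum_lim; have /has_sum_ext := has_sumZ (x `^ (nu * n%:R))^-1 lL.
apply => m; rewrite /lim_term gt0_powRD// powR_mulrn ?(ltW x0)//.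
rewrite negbinE (exprNn x).
rewrite (_ : alpha * m%:R + (alpha * nu * n%:R + 1) =
  alpha * (m%:R + n%:R * nu) + 1); last by ring.
rewrite [nu * _]mulrC in X0 *; set X := x `^ _ in X0 *.
transitivity ((X^-1 * X) * ((-1) ^+ m * (x ^+ m * (pochhammer (n%:R * nu) m / m`!%:R) /
  Gamma (alpha * (m%:R + n%:R * nu) + 1)))).
  by ring.
by rewrite mulVf// mul1r; ring.
Qed.

Hypothesis convcdf_small : forall (xi : R) n t,
  0 < xi -> (t < n)%N -> convcdf (p xi) n t = 0.

Lemma mean_scaling_limit :
  let b := fun n : nat => x `^ (nu * n.+1%:R) *
    prabhakar alpha (alpha * nu * n.+1%:R + 1) (nu * n.+1%:R) (- x) in
  exists2 L, has_sum b L &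
    \sum_(1 <= n < N.+1) convcdf (p (xiN N)) n N @[N --> \oo] --> L.
Proof.
move=> b.
have r0 : 0 < (3^-1 : R) `^ nu by rewrite powR_gt0.
have r1 : `|(3^-1) `^ nu| < 1 :> R.
  rewrite gtr0_norm//; have h3 : 3^-1 < 1 :> R by rewrite invf_lt1// ltr1n.
  by have := gt0_ltr_powR nu0 _ _ h3; rewrite powR1; apply; rewrite nnegrE.
have geo : has_sum (fun n => expR (2 * K) * ((3^-1) `^ nu) ^+ n.+1)
    (expR (2 * K) * (3^-1) `^ nu / (1 - (3^-1) `^ nu)).
  have /has_sum_ext := @cvg_geometric_series R (expR (2 * K) * (3^-1) `^ nu) _ r1.
  by apply => n; rewrite /= exprS mulrA.
apply: (has_sum_tannery (F := fun N n => convcdf (p (xiN N)) n.+1 N) geo).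
- by apply: filterS convcdf_le => N h n; exact: h.
- move=> n; have [L lL cL] := convcdf_cvg (ltn0Sn n).
  by rewrite /b (prabhakar_lim (ltn0Sn n) lL).
(* For fixed N the series over n is the finite sum in disguise: its terms vanish once n + 1 > N. *)
- apply: filterS uN_near => N [_ _ _ xi0 _].
  rewrite /has_sum; apply: cvg_near_cst; near=> m.
  have Nm : (N <= m)%N by near: m; exact: nbhs_infty_ge.
  rewrite /series/= (big_cat_nat (n := N))//= [X in _ + X]big1_seq ?addr0.
    by rewrite big_add1.
  move=> i; rewrite mem_index_iota => /andP[_ /andP[Ni _]].
  by rewrite convcdf_small.
Unshelve. all: by end_near. Qed.

End scaling_limit.

Lemma truncn_div_cvgy {R : realType} (t : R) : 0 < t ->
  Num.truncn (t / h) @[h --> 0^'+] --> \oo.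
Proof.
move=> t0; apply/cvgnyPge => A.
have tA : 0 < t / A.+1%:R by rewrite divr_gt0.
near=> h.
have h0 : 0 < h by near: h; exact: nbhs_right_gt.
have hA : h <= t / A.+1%:R by near: h; apply: nbhs_right_le.
apply: leq_trans (leqnSn A) _.
rewrite truncn_ge_nat ?divr_ge0 ?(ltW t0) ?(ltW h0)//.
by rewrite ler_pdivlMr// mulrC -ler_pdivlMr.
Unshelve. all: by end_near. Qed.

Theorem mainTheorem9 (R : realType) (alpha nu : R)
    (halpha0 : 0 < alpha) (halpha1 : alpha <= 1) (hnu : 0 < nu)
    (d : R -> measure_display) (T : forall xi : R, measurableType (d xi))
    (P : forall xi : R, probability (T xi) R)
    (Z : forall xi : R, nat -> {RV (P xi) >-> nat})
    (hZ : forall xi : R, 0 < xi -> is_PDTP (Z xi) alpha nu xi) :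
  (forall (xi : R) (t : nat), 0 < xi -> xi < 1 ->
    let a := fun m : nat => \sum_(1 <= n < t.+1)
      (-1) ^+ m / m`!%:R * xi `^ (nu * n%:R + m%:R) *
      (pochhammer (n%:R * nu) m / (t - n)`!%:R) *
      pochhammer (alpha * (m%:R + n%:R * nu) + 1) (t - n) in
    cvgn (series a) /\
    mean_arrivals (Z xi) t = (limn (series a))%:E) /\
  (forall (xi0 t : R), 0 < xi0 -> 0 < t ->
    (* k stands for the index n + 1 >= 1 *)
    let b := fun n : nat => let k : R := n.+1%:R in
      xi0 `^ (nu * k) * t `^ (alpha * nu * k) *
      prabhakar alpha (alpha * nu * k + 1) (nu * k) (- xi0 * t `^ alpha) in
    cvgn (series b) /\
    mean_arrivals (Z (xi0 * h `^ alpha)) (Num.truncn (t / h))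
      @[h --> within [set h : R | t / h \is a Num.nat] 0^'+]
      --> (limn (series b))%:E).
Proof.
pose p xi := interarrival_pmf (Z xi).
have p0 (xi : R) k : 0 < xi -> 0 <= p xi k by move=> _; exact: interarrival_pmf_ge0.
have pgf (xi u : R) : 0 < xi -> 0 <= u < 1 ->
    has_sum (fun k => p xi k * u ^+ k)
      (xi `^ nu * u / (xi + (1 - u) `^ alpha) `^ nu).
  by move=> xi0; exact: (PDTP_pmf_has_sum xi0 (hZ _ xi0)).
(* The mean depends on the process only through the law [p xi], so letting the probability space
   vary with xi does no harm. *)
have meanE (xi : R) t : 0 < xi ->
    mean_arrivals (Z xi) t = (\sum_(1 <= n < t.+1) convcdf (p xi) n t)%:E.
  move=> /hZ[pos ind idd _]; exact: mean_arrivalsE.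
have small (xi : R) n t : 0 < xi -> (t < n)%N -> convcdf (p xi) n t = 0.
  move=> /hZ[pos ind idd _]; exact: convcdf0.
split=> [xi t xi0 xi1 a|xi0 t xi00 t0 b].
  have aS : has_sum a (\sum_(1 <= n < t.+1) convcdf (p xi) n t).
    have /has_sum_ext := PDTP_mean_has_sum halpha0 hnu xi0 (hZ _ xi0) (t := t) xi1.
    apply => m; apply: eq_bigr => n _.
    by rewrite /pdtp_cdf_term !negbinE; ring.
  split; first exact: has_sum_cvg aS.
  by rewrite meanE// (has_sum_lim aS).
pose x := xi0 * t `^ alpha.
have x0 : 0 < x by rewrite mulr_gt0// powR_gt0.
have [L bL mL] := mean_scaling_limit halpha0 hnu x0 p0 pgf small.
have bE : has_sum b L.
  have /has_sum_ext := bL; apply => n; rewrite /b.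
  rewrite /x powRM ?powR_ge0 ?(ltW xi00)// -powRrM mulNr.
  by rewrite [alpha * (nu * _)]mulrA.
split; first exact: has_sum_cvg bE.
rewrite (has_sum_lim bE).
set F := within _ _.
(* The limit in h is reduced to the limit along N = t / h. *)
have trunc_cvg : Num.truncn (t / h) @[h --> F] --> \oo.
  by apply: cvg_trans (@truncn_div_cvgy R t t0); apply: cvg_app; exact: cvg_within.
have mF := cvg_comp _ _ trunc_cvg mL.
have : (EFin \o ((fun N => \sum_(1 <= n < N.+1) convcdf (p (x * N%:R `^ (- alpha))) n N)
    \o (fun h => Num.truncn (t / h)))) @ F --> L%:E.
  by apply/fine_cvgP; split => //; exact: nearW.
apply: cvg_trans; apply: near_eq_cvg; near=> h.
have h0 : 0 < h by near: h; apply: cvg_within; exact: nbhs_right_gt.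
have hN : t / h \is a Num.nat by near: h; exact: withinT.
rewrite /= meanE ?mulr_gt0 ?powR_gt0//.
(* On the filter t / h is a natural number, so truncation loses nothing and the parameters agree
   exactly. *)
suff -> : x * (Num.truncn (t / h))%:R `^ (- alpha) = xi0 * h `^ alpha by [].
rewrite truncnK// /x powRM ?invr_ge0 ?(ltW t0) ?(ltW h0)//.
rewrite -(powR_inv1 (ltW h0)) -(powRrM h) mulrNN mul1r powRN.
by rewrite -mulrA mulVKf// gt_eqF// powR_gt0.
Unshelve. all: by end_near. Qed.
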